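(* There exist absolute constants $\alpha,\beta>0$ (not depending on $l,n,\mu_1,\mu_2$) such that the following holds. Let $f=\frac1n\sum_{i=1}^nf_i:\mathbb{R}^{d_1}\times\mathbb{R}^{d_2}\to\mathbb{R}$, where each $f_i$ is continuously differentiable with $l$-Lipschitz gradients, suppose $f$ satisfies the existence-of-saddle-point assumption and the two-sided PL condition with constants $\mu_1,\mu_2>0$, where $\mu_1,\mu_2\le l$, set $\kappa=l/\min(\mu_1,\mu_2)$, and assume $n\le\kappa^9$. Run VR-AGDA with $$\tau_1=\frac{\beta}{28\kappa^2ln^{2/3}},\quad \tau_2=\frac{\beta}{ln^{2/3}},\quad N=\Big\lfloor\alpha\beta^{-3/2}n\big(2+4\beta^{1/2}n^{-1/3}\big)^{-1}\Big\rfloor,\quad T=\big\lceil\kappa^3n^{-1/3}\big\rceil,$$ and put $P_k=a^k+\frac1{20}b^k$. Then $P_{k+1}\le\frac12P_k$ for all $k$. Consequently, VR-AGDA achieves an $\epsilon$-optimal solution with total complexity $$\mathcal{O}\big(n^{2/3}\kappa^3\log(1/\epsilon)\big).$$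
   Context: Norms are Euclidean. Problem: $\min_x\max_y f(x,y)=\frac1n\sum_{i=1}^nf_i(x,y)$. $f_i$ has $l$-Lipschitz gradients: for all $x_1,x_2\in\mathbb{R}^{d_1}$, $y_1,y_2\in\mathbb{R}^{d_2}$, $\|\nabla_x f_i(x_1,y_1)-\nabla_x f_i(x_2,y_2)\|\le l[\|x_1-x_2\|+\|y_1-y_2\|]$ and $\|\nabla_y f_i(x_1,y_1)-\nabla_y f_i(x_2,y_2)\|\le l[\|x_1-x_2\|+\|y_1-y_2\|]$. Existence of saddle point: there is $(x^*,y^* )$ with $f(x^*,y)\le f(x^*,y^* )\le f(x,y^* )$ for all $(x,y)$; moreover for every $y$, $\min_x f(x,y)$ has a nonempty solution set and finite optimal value, and for every $x$, $\max_y f(x,y)$ has a nonempty solution set and finite optimal value. Two-sided PL condition with constants $\mu_1,\mu_2>0$ (imposed on $f$, not on the individual $f_i$): for all $(x,y)$, $\|\nabla_x f(x,y)\|^2\ge 2\mu_1[f(x,y)-\min_{x'}f(x',y)]$ and $\|\nabla_y f(x,y)\|^2\ge 2\mu_2[\max_{y'}f(x,y')-f(x,y)]$. VR-AGDA: input an initial point $(\tilde x_0,\tilde y_0)$, stepsizes $\tau_1,\tau_2$ and iteration numbers $N,T$. For each epoch $k=0,1,2,\dots$: for $t=0,\dots,T-1$, set $x_{t,0}=\tilde x_t$, $y_{t,0}=\tilde y_t$, compute the full gradients $\nabla_xf(\tilde x_t,\tilde y_t)$ and $\nabla_yf(\tilde x_t,\tilde y_t)$; for $j=0,\dots,N-1$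 sample i.i.d. indices $i_j^1,i_j^2$ uniformly from $\{1,\dots,n\}$ (independent of the past) and set $x_{t,j+1}=x_{t,j}-\tau_1[\nabla_xf_{i_j^1}(x_{t,j},y_{t,j})-\nabla_xf_{i_j^1}(\tilde x_t,\tilde y_t)+\nabla_xf(\tilde x_t,\tilde y_t)]$, $y_{t,j+1}=y_{t,j}+\tau_2[\nabla_yf_{i_j^2}(x_{t,j+1},y_{t,j})-\nabla_yf_{i_j^2}(\tilde x_t,\tilde y_t)+\nabla_yf(\tilde x_t,\tilde y_t)]$; then set $\tilde x_{t+1}=x_{t,N}$, $\tilde y_{t+1}=y_{t,N}$. After the loop over $t$, choose $(x^k,y^k)$ uniformly at random from $\{(x_{t,j},y_{t,j}):0\le j\le N-1,\ 0\le t\le T-1\}$ and restart the next epoch with $\tilde x_0=x^k$, $\tilde y_0=y^k$. Notation: $g(x):=\max_yf(x,y)$, $g^*:=\min_xg(x)$, $a^k=\mathbb{E}[g(x^k)-g^*]$, $b^k=\mathbb{E}[g(x^k)-f(x^k,y^k)]$. An $\epsilon$-optimal solution means an output $(x^k,y^k)$ with $P_k\le\epsilon$. Total complexity is the number of evaluations of component gradients $\nabla f_i$ (a full gradient costs $n$); $\mathcal{O}$ hides absolute constants, with the initial potential value treated as a constant inside the logarithm. *)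

(* Defs.v *)
From HB Require Import structures.
From mathcomp Require Import all_boot all_order all_algebra.
From mathcomp Require Import all_classical all_reals all_analysis.
Set Implicit Arguments.
Unset Strict Implicit.
Unset Printing Implicit Defensive.
Import Order.TTheory GRing.Theory Num.Theory.
Import numFieldNormedType.Exports.
Local Open Scope classical_set_scope.
Local Open Scope ring_scope.

(* The canonical norm on matrices in MathComp-Analysis is the sup norm, hence
   an explicit Euclidean norm; both induce the same topology, so
   differentiability and continuity below are unaffected. *)
Definition enorm (R : realType) (d : nat) (v : 'rV[R]_d) : R :=
  Num.sqrt (\sum_(i < d) v 0 i ^+ 2).

Section Objective.
Variables (R : realType) (d1 d2 : nat).
Local Notation point := ('rV[R]_d1 * 'rV[R]_d2)%type.
Implicit Types (f : point -> R) (z : point).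

Definition gradx f z : 'rV[R]_d1 :=
  \row_(i < d1) 'D_(delta_mx 0 i) (fun x => f (x, z.2)) z.1.

Definition grady f z : 'rV[R]_d2 :=
  \row_(i < d2) 'D_(delta_mx 0 i) (fun y => f (z.1, y)) z.2.

Definition continuously_differentiable f :=
  [/\ forall z, differentiable f z, continuous (gradx f) & continuous (grady f)].

Definition lipschitz_gradients (l : R) f := forall z w,
  enorm (gradx f z - gradx f w) <= l * (enorm (z.1 - w.1) + enorm (z.2 - w.2)) /\
  enorm (grady f z - grady f w) <= l * (enorm (z.1 - w.1) + enorm (z.2 - w.2)).

(* Since f is real-valued, attainment of an optimum also gives finiteness of
   the optimal value. *)
Definition saddle_point_assumption f :=
  [/\ exists zs : point, forall x y, f (zs.1, y) <= f zs <= f (x, zs.2),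
      forall y, exists x0, forall x, f (x0, y) <= f (x, y)
    & forall x, exists y0, forall y, f (x, y) <= f (x, y0)].

(* The inf and sup below are a min and a max under saddle_point_assumption. *)
Definition minx f (y : 'rV[R]_d2) : R := inf (range (fun x => f (x, y))).
Definition maxy f (x : 'rV[R]_d1) : R := sup (range (fun y => f (x, y))).
Definition minimax f : R := inf (range (maxy f)).

Definition two_sided_PL (mu1 mu2 : R) f := forall z,
  2 * mu1 * (f z - minx f z.2) <= enorm (gradx f z) ^+ 2 /\
  2 * mu2 * (maxy f z.1 - f z) <= enorm (grady f z) ^+ 2.

Definition average (n : nat) (fs : 'I_n -> point -> R) : point -> R :=
  fun z => n%:R^-1 * \sum_(i < n) fs i z.

End Objective.

Section Algorithm.
Variables (R : realType) (d1 d2 n N T : nat).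
Local Notation point := ('rV[R]_d1 * 'rV[R]_d2)%type.
Variables (fs : 'I_n -> point -> R) (tau1 tau2 : R).
Local Notation f := (average fs).

(* [zt] is the snapshot at which full gradients are taken. *)
Definition vr_step (zt z : point) (i : 'I_n * 'I_n) : point :=
  let x := z.1 - tau1 *:
    (gradx (fs i.1) z - gradx (fs i.1) zt + gradx f zt) in
  let y := z.2 + tau2 *:
    (grady (fs i.2) (x, z.2) - grady (fs i.2) zt + grady f zt) in
  (x, y).

(* (x_{t,j}, y_{t,j}) from the snapshot [zt] and the index pairs of the loop;
   [codom i] lists i 0, ..., i (N-1) in this order. *)
Definition inner_iterate (zt : point) (i : 'I_N -> 'I_n * 'I_n) (j : nat) :=
  foldl (vr_step zt) zt (take j (codom i)).

Definition snapshot (z0 : point) (i : 'I_T -> 'I_N -> 'I_n * 'I_n) (t : nat) :=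
  foldl (fun zt it => inner_iterate zt it N) z0 (take t (codom i)).

Definition epoch (z0 : point) (i : 'I_T -> 'I_N -> 'I_n * 'I_n)
    (s : 'I_T * 'I_N) : point :=
  inner_iterate (snapshot z0 i s.1) (i s.1) s.2.

(* (x^k, y^k), the output of epoch k; epoch 0 starts from the input point. *)
Fixpoint vr_agda (z0 : point) (i : nat -> 'I_T -> 'I_N -> 'I_n * 'I_n)
    (s : nat -> 'I_T * 'I_N) (k : nat) : point :=
  epoch (if k is k'.+1 then vr_agda z0 i s k' else z0) (i k) (s k).

(* Evaluations of component (partial) gradients during one epoch: for each t,
   n for each of the two full gradients, and in each inner step two
   evaluations of grad_x f_i and two of grad_y f_i. *)
Definition epoch_cost : nat := (\sum_(t < T) (n + n + \sum_(j < N) (2 + 2)))%N.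

End Algorithm.

Section Sampling.
Variables (R : realType) (d : measure_display) (Omega : measurableType d).
Variable P : probability Omega R.

(* For finitely-valued variables the product rule on singletons is equivalent
   to independence of the generated sigma-algebras. *)
Definition independent_uniform (L : Type) (V : L -> finType)
    (X : forall a : L, Omega -> V a) : Prop :=
  [/\ forall a v, measurable [set w | X a w = v],
      forall a v, P [set w | X a w = v] = (#|V a|%:R^-1)%:E
    & forall (J : finType) (a : J -> L), injective a ->
      forall v : forall j, V (a j),
      P [set w | forall j, X (a j) w = v j] =
      (\prod_(j : J) P [set w | X (a j) w = v j])%E].

Variables (n N T : nat).

Inductive draw_label : Type :=
  | IndexX of nat & 'I_T & 'I_N
  | IndexY of nat & 'I_T & 'I_N
  | Output of nat.

Definition draw_type (a : draw_label) : finType :=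
  match a with
  | IndexX _ _ _ => 'I_n
  | IndexY _ _ _ => 'I_n
  | Output _ => ('I_T * 'I_N)%type
  end.

Definition draws (i1 i2 : nat -> 'I_T -> 'I_N -> Omega -> 'I_n)
    (s : nat -> Omega -> 'I_T * 'I_N) (a : draw_label) : Omega -> draw_type a :=
  match a return Omega -> draw_type a with
  | IndexX k t j => i1 k t j
  | IndexY k t j => i2 k t j
  | Output k => s k
  end.

End Sampling.

Section Potential.
Variables (R : realType) (d1 d2 : nat).
Local Notation point := ('rV[R]_d1 * 'rV[R]_d2)%type.
Variable f : point -> R.

Definition gap_a (z : point) : R := maxy f z.1 - minimax f.
Definition gap_b (z : point) : R := maxy f z.1 - f z.

Definition initial_potential (z : point) : R := gap_a z + 1 / 20 * gap_b z.

Definition potential (d : measure_display) (Omega : measurableType d)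
    (P : probability Omega R) (Z : Omega -> point) : \bar R :=
  ('E_P[fun w => gap_a (Z w)] + (1 / 20)%:E * 'E_P[fun w => gap_b (Z w)])%E.

End Potential.

(* Main.v *)
Require Import Defs.
From HB Require Import structures.
From mathcomp Require Import all_boot all_order all_algebra.
From mathcomp Require Import all_classical all_reals all_analysis.
From mathcomp Require Import measurable_realfun ring lra.
Set Implicit Arguments.
Unset Strict Implicit.
Unset Printing Implicit Defensive.
Import Order.TTheory GRing.Theory Num.Theory.
Import numFieldNormedType.Exports.
Local Open Scope classical_set_scope.
Local Open Scope ring_scope.

(* Fix one inner loop with snapshot zt and let D be the squared distance to zt.
   The function g = max_y f(., y) is O(kappa l)-smooth with gradient grad_x f(x, y1),
   y1 any maximiser, and is PL in x; quadratic growth bounds the distance from y to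
   the nearest y1 by the gap b. Hence one step lowers the potential a + b / 20 by a
   fraction u^2 / (28 kappa^3), where u = beta^(1/2) / n^(1/3), up to the variance
   of the gradient estimators, which is at most 2 l^2 D. The Lyapunov functions
   a + b / 20 + l c_j D with c_j = (N - j) u^4 / 5 absorb this variance, since
   N u^3 <= 1 / 80 keeps c_j below u / 400. They start from D = 0, so telescoping
   over j and then over t bounds the sum of all the expected potentials of an epoch
   by 28 kappa^3 / u^2 times the initial one; the output is a uniform sample of
   N T >= 56 kappa^3 / u^2 iterates, hence the factor 1/2. All draws being uniform
   and independent, expectations are averages over finite sets of histories. *)

(** * Euclidean geometry and smooth functions *)

Section Euclidean.
Variables (R : realType) (d : nat).
Implicit Types u v w : 'rV[R]_d.

Definition dot u v : R := \sum_(i < d) u 0 i * v 0 i.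

Lemma dotC u v : dot u v = dot v u.
Proof. by apply: eq_bigr => i _; rewrite mulrC. Qed.

Lemma dotDl u v w : dot (u + v) w = dot u w + dot v w.
Proof. by rewrite -big_split; apply: eq_bigr => i _; rewrite mxE mulrDl. Qed.

Lemma dotZl a u v : dot (a *: u) v = a * dot u v.
Proof. by rewrite mulr_sumr; apply: eq_bigr => i _; rewrite mxE mulrA. Qed.

Lemma dotNl u v : dot (- u) v = - dot u v.
Proof. by rewrite -scaleN1r dotZl mulN1r. Qed.

Lemma dotBl u v w : dot (u - v) w = dot u w - dot v w.
Proof. by rewrite dotDl dotNl. Qed.

Lemma dotDr u v w : dot w (u + v) = dot w u + dot w v.
Proof. by rewrite !(dotC w) dotDl. Qed.

Lemma dotZr a u v : dot v (a *: u) = a * dot v u.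
Proof. by rewrite !(dotC v) dotZl. Qed.

Lemma dotNr u v : dot v (- u) = - dot v u.
Proof. by rewrite !(dotC v) dotNl. Qed.

Lemma dot_sumr (I : finType) (F : I -> 'rV[R]_d) u :
  dot u (\sum_i F i) = \sum_i dot u (F i).
Proof.
rewrite [RHS]exchange_big; apply: eq_bigr => j _.
by rewrite summxE mulr_sumr.
Qed.

Lemma enorm_ge0 u : 0 <= enorm u.
Proof. exact: sqrtr_ge0. Qed.

Lemma sqr_enorm u : enorm u ^+ 2 = dot u u.
Proof.
rewrite /enorm sqr_sqrtr; first by apply: eq_bigr => i _; rewrite expr2.
by apply: sumr_ge0 => i _; rewrite sqr_ge0.
Qed.

Lemma sqr_enormD u v :
  enorm (u + v) ^+ 2 = enorm u ^+ 2 + 2 * dot u v + enorm v ^+ 2.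
Proof. rewrite !sqr_enorm !dotDl !dotDr (dotC v u); ring. Qed.

Lemma sqr_enormZ a u : enorm (a *: u) ^+ 2 = a ^+ 2 * enorm u ^+ 2.
Proof. by rewrite !sqr_enorm dotZl dotZr mulrA expr2. Qed.

Lemma enormN u : enorm (- u) = enorm u.
Proof. by rewrite /enorm; under eq_bigr do rewrite mxE sqrrN. Qed.

Lemma enormZ a u : 0 <= a -> enorm (a *: u) = a * enorm u.
Proof.
move=> a0; apply/eqP; rewrite -(@eqrXn2 _ 2) ?enorm_ge0 ?mulr_ge0 ?enorm_ge0//.
by rewrite sqr_enormZ exprMn.
Qed.

Lemma sqr_enormB u v :
  enorm (u - v) ^+ 2 = enorm u ^+ 2 - 2 * dot u v + enorm v ^+ 2.
Proof. rewrite sqr_enormD dotNr enormN; ring. Qed.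

Lemma dot_young a u v : 0 < a ->
  2 * dot u v <= enorm u ^+ 2 / a + a * enorm v ^+ 2.
Proof.
move=> a0; have := sqr_ge0 (enorm (u - a *: v)).
rewrite sqr_enormB sqr_enormZ dotZr => h.
rewrite -(ler_pM2l a0) mulrDr [X in _ <= X + _]mulrC divfK ?gt_eqF//; lra.
Qed.

Lemma coord_le_enorm u i : `|u 0 i| <= enorm u.
Proof.
rewrite -(@ler_pXn2r _ 2) ?nnegrE ?enorm_ge0// sqr_enorm real_normK ?num_real//.
rewrite /dot (bigD1 i)//= -expr2 lerDl; apply: sumr_ge0 => j _.
by rewrite -expr2 sqr_ge0.
Qed.

Lemma dot_le u v : dot u v <= enorm u * enorm v.
Proof.
have dot0 w w' : enorm w = 0 -> dot w w' = 0.
  move=> w0; apply: big1 => i _; have := coord_le_enorm w i.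
  by rewrite w0 normr_le0 => /eqP ->; rewrite mul0r.
have [u0|u0] := eqVneq (enorm u) 0; first by rewrite dot0// u0 mul0r.
have [v0|v0] := eqVneq (enorm v) 0; first by rewrite dotC dot0// v0 mulr0.
have uv0 : 0 < enorm u * enorm v by rewrite mulr_gt0// lt0r ?u0 ?v0 enorm_ge0.
have := sqr_ge0 (enorm (enorm v *: u - enorm u *: v)).
rewrite sqr_enormB !sqr_enormZ dotZl dotZr => h.
rewrite -(ler_pM2l uv0); lra.
Qed.

Lemma ler_enormD u v : enorm (u + v) <= enorm u + enorm v.
Proof.
rewrite -(@ler_pXn2r _ 2) ?nnegrE ?addr_ge0 ?enorm_ge0// sqr_enormD.
by have := dot_le u v; lra.
Qed.

(** Boundedness, hence compactness, is phrased with the sup norm; this transfers Euclidean bounds to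
    it. *)
Lemma norm_le_enorm u : `|u| <= enorm u.
Proof.
rewrite [leLHS]/Num.Def.normr/= mx_normrE.
apply/bigmax_leP; split => [|[i j] _ /=]; first exact: enorm_ge0.
by rewrite ord1 coord_le_enorm.
Qed.

Lemma continuous_enorm : continuous (@enorm R d).
Proof.
have cs : continuous (fun v : 'rV[R]_d => \sum_i v 0 i ^+ 2).
  apply: continuous_big => [|i _ u]; first exact: add_continuous.
  apply: (@continuous_comp _ _ _ (fun v : 'rV[R]_d => v 0 i) (fun t : R => t ^+ 2)).
    exact: coord_continuous.
  exact: exprn_continuous.
by move=> u; apply: continuous_comp; [exact: cs | exact: sqrt_continuous].
Qed.

End Euclidean.

Section Smoothness.
Variables (R : realType) (d : nat) (h : 'rV[R]_d -> R).

Definition grad (x : 'rV[R]_d) : 'rV[R]_d :=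
  \row_(i < d) 'D_(delta_mx 0 i) h x.

Hypothesis dh : forall x, differentiable h x.

Lemma derive_grad x u : 'D_u h x = dot (grad x) u.
Proof.
rewrite deriveE// {1}(row_sum_delta u) linear_sum/=; apply: eq_bigr => i _.
by rewrite linearZ/= mxE deriveE// mulrC.
Qed.

Lemma is_derive_line x u (t : R) :
  is_derive t (1 : R) (fun s : R => h (x + s *: u)) (dot (grad (x + t *: u)) u).
Proof.
have E : (fun k : R => k^-1 *: (((fun s : R => h (x + s *: u)) \o shift t) (k *: 1) -
    h (x + t *: u))) =
  (fun k => k^-1 *: ((h \o shift (x + t *: u)) (k *: u) - h (x + t *: u))).
  apply/funext => k /=; congr (_ *: (h _ - _)).
  by rewrite [k *: 1]mulr1 scalerDl addrCA.
split; first by rewrite /derivable E; exact: diff_derivable.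
by rewrite -derive_grad /derive E.
Qed.

Variable l : R.
Hypothesis hl : forall x y, enorm (grad x - grad y) <= l * enorm (x - y).

(** On the segment, [phi] is [h] minus its quadratic model; its derivative is nonpositive on the
    open unit interval, so [phi 1 <= phi 0]. *)
Lemma smooth_le x u :
  h (x + u) <= h x + dot (grad x) u + l / 2 * enorm u ^+ 2.
Proof.
pose c := l / 2 * enorm u ^+ 2.
pose F (s : R) := h (x + s *: u).
pose q : R -> R := dot (grad x) u \*: (@id R) + c \*: ((@id R) ^+ 2).
have dF (t : R) : is_derive t (1 : R) F (dot (grad (x + t *: u)) u).
  exact: is_derive_line.
have dq (t : R) : is_derive t (1 : R) q (dot (grad x) u + c * (2 * t)).
  have did := is_derive_id t (1 : R).
  apply: (is_derive_eq (is_deriveD (is_deriveZ (dot (grad x) u) did)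
    (is_deriveZ c (is_deriveX 2 did)))).
  by rewrite ![_ *: _]/GRing.scale/= expr1 !mulr1.
have dphi (t : R) := is_deriveB (dF t) (dq t).
set phi := F - q in dphi.
have cphi : continuous phi.
  by move=> t; apply/differentiable_continuous/derivable1_diffP.
have : phi 1 <= phi 0.
  apply: (@ler0_derive1_le_cc _ phi 0 1) => //.
  (* By Cauchy-Schwarz and the Lipschitz bound, [dot (grad (x + t *: u) - grad x) u] is at most
     [l * t * enorm u ^+ 2], the derivative of [c * t ^+ 2]. *)
  - move=> t /[!in_itv]/= /andP[t0 _]; rewrite derive1E derive_val.
    have := dot_le (grad (x + t *: u) - grad x) u.
    have := hl (x + t *: u) x.
    rewrite [x + _]addrC addrK enormZ ?(ltW t0)// [_ + x]addrC dotBl /c.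
    have := enorm_ge0 u; have := enorm_ge0 (grad (x + t *: u) - grad x); nra.
  - exact: continuous_subspaceT.
  - by rewrite in_itv/= lexx ler01.
  - by rewrite in_itv/= lexx ler01.
have phiE (s : R) : phi s = h (x + s *: u) - (dot (grad x) u * s + c * s ^+ 2).
  by rewrite expr2.
by rewrite !phiE scale1r scale0r addr0 /c; lra.
Qed.

End Smoothness.

Lemma smooth_ge (R : realType) (d : nat) (h : 'rV[R]_d -> R) (l : R) :
  (forall x, differentiable h x) ->
  (forall x y, enorm (grad h x - grad h y) <= l * enorm (x - y)) ->
  forall x u, h x + dot (grad h x) u - l / 2 * enorm u ^+ 2 <= h (x + u).
Proof.
move=> dh hl x u.
have gN z : grad (- h) z = - grad h z.
  by apply/rowP => i; rewrite !mxE deriveN//; exact: diff_derivable.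
have dN z : differentiable (- h) z by exact: differentiableN.
have lN y z : enorm (grad (- h) y - grad (- h) z) <= l * enorm (y - z).
  by rewrite !gN -opprD enormN.
have := smooth_le dN lN x u; rewrite gN dotNl.
have -> z : (- h) z = - h z by [].
have -> z : (- h) z = - h z by [].
lra.
Qed.

(** * PL functions and the primal function *)

(* The minimiser z of sqrt(h - m) + sqrt(mu / 3) |. - y| satisfies h z = m:
   otherwise, as |G z|^2 >= 2 mu (h z - m), a short gradient step from z would
   lower the first term by more than it raises the second. *)
Lemma PL_quadratic_growth (R : realType) (d : nat) (h : 'rV[R]_d -> R)
    (G : 'rV[R]_d -> 'rV[R]_d) (l mu m : R) :
  0 < mu -> mu <= l -> continuous h ->
  (forall x u, h (x + u) <= h x + dot (G x) u + l / 2 * enorm u ^+ 2) ->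
  (forall x, m <= h x) ->
  (forall x, 2 * mu * (h x - m) <= enorm (G x) ^+ 2) ->
  forall y, exists2 z, h z = m & mu * enorm (z - y) ^+ 2 <= 3 * (h y - m).
Proof.
move=> mu0 mul ch smooth mh PL y.
have l0 : 0 < l by exact: lt_le_trans mul.
(* Infinitesimal steps would allow any [g ^+ 2] below [mu / 2]; the value [mu / 3] leaves room for a
   step of finite length. *)
pose g := Num.sqrt (mu / 3).
have g0 : 0 < g by rewrite sqrtr_gt0 divr_gt0.
have g2 : g ^+ 2 = mu / 3 by rewrite sqr_sqrtr// divr_ge0// ltW.
pose phi z := Num.sqrt (h z - m) + g * enorm (z - y).
have c1 : continuous (fun z => Num.sqrt (h z - m)).
  move=> z; apply: continuous_comp; last exact: sqrt_continuous.
  by apply: continuousB; [exact: ch | exact: cst_continuous].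
have c2 : continuous (fun z : 'rV[R]_d => enorm (z - y)).
  move=> z; apply: continuous_comp; last exact: continuous_enorm.
  by apply: continuousB; [exact: cvg_id | exact: cst_continuous].
have cphi : continuous phi.
  move=> z.
  have c3 : {for z, continuous (fun z : 'rV[R]_d => g * enorm (z - y))}.
    by apply: continuousM; [exact: cst_continuous | exact: c2].
  exact: (continuousD (c1 z) c3).
(* Since [phi z] dominates [g * enorm (z - y)], this sublevel set is compact, and a minimiser over
   it is global. *)
pose A := [set z | phi z <= phi y].
have cA : compact A.
  apply: bounded_closed_compact.
    exists (phi y / g + `|y|); split => [|b /ltW yb z /= Az].
      exact: num_real.
    apply: le_trans yb; rewrite -[z](subrK y) (le_trans (ler_normD _ _))// lerD2r.
    rewrite (le_trans (norm_le_enorm _))// ler_pdivlMr// mulrC.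
    by apply: le_trans Az; rewrite lerDr sqrtr_ge0.
  have -> : A = phi @^-1` [set t | t <= phi y] by [].
  by apply: closed_comp => [t _|]; [exact: cphi | exact: closed_le].
have [|z zA zmin] := @EVT_min_rV R d phi A _ cA (continuous_subspaceT cphi).
  by exists y; rewrite /A/=.
have {}zmin t : phi z <= phi t.
  have [ty|/ltW yt] := leP (phi t) (phi y); first by apply: zmin; rewrite inE.
  by apply: le_trans yt; move: zA; rewrite inE.
have hz : h z = m.
  apply/eqP; rewrite eq_le mh andbT leNgt -subr_gt0; apply/negP => dz.
  pose r := Num.sqrt (h z - m).
  have r0 : 0 < r by rewrite sqrtr_gt0.
  have r2 : r ^+ 2 = h z - m by rewrite sqr_sqrtr// ltW.
  (* With [eta * l = 1 / 4] the second-order term eats only an eighth of the first-order gain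
     [eta * n ^+ 2]. *)
  pose eta := (4 * l)^-1.
  have eta0 : 0 < eta by rewrite invr_gt0 mulr_gt0.
  have etal : eta * l = 1 / 4 by rewrite /eta; field; rewrite gt_eqF.
  pose z' := z - eta *: G z.
  pose r' := Num.sqrt (h z' - m).
  have r'2 : r' ^+ 2 = h z' - m by rewrite sqr_sqrtr// subr_ge0.
  have r'0 : 0 <= r' by exact: sqrtr_ge0.
  set n := enorm (G z).
  have n0 : 0 <= n by exact: enorm_ge0.
  have nr : 2 * mu * r ^+ 2 <= n ^+ 2 by rewrite r2 PL.
  have decr : r' ^+ 2 <= r ^+ 2 - 7 / 8 * eta * n ^+ 2.
    rewrite r2 r'2; have := smooth z (- (eta *: G z)).
    rewrite dotNr dotZr enormN sqr_enormZ -sqr_enorm -/z' -/n.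
    have -> : l / 2 * (eta ^+ 2 * n ^+ 2) = (eta * l) / 2 * eta * n ^+ 2 by ring.
    by rewrite etal; lra.
  have tri : r <= r' + g * eta * n.
    have := zmin z'; rewrite /phi -/r -/r'.
    have -> : z' - y = (z - y) + - (eta *: G z) by rewrite addrAC.
    have := ler_enormD (z - y) (- (eta *: G z)).
    rewrite enormN enormZ ?(ltW eta0)// -/n => t1 t2.
    have := ler_wpM2l (ltW g0) t1; rewrite mulrDr mulrA; lra.
  have n_gt0 : 0 < n by rewrite lt0r n0 andbT; apply/eqP => n00; nra.
  (* [r - g * eta * n <= r'] can be squared only if its left side is nonnegative. Then [49 / 64 * n
     ^+ 2 <= 4 / 3 * mu * r ^+ 2 <= 2 / 3 * n ^+ 2]; otherwise [7 / 8 < mu / 3 * eta]. Both are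
     absurd. *)
  have [ler|ltr] := leP (g * eta * n) r.
    have h1 : (r - g * eta * n) ^+ 2 <= r' ^+ 2.
      by rewrite ler_pXn2r ?nnegrE//; lra.
    have h2 : 7 / 8 * eta * n ^+ 2 <= 2 * g * eta * n * r by nra.
    have h3 : 7 / 8 * n <= 2 * g * r.
      have en0 : 0 < eta * n by rewrite mulr_gt0.
      by rewrite -(ler_pM2l en0); lra.
    have h4 : (7 / 8 * n) ^+ 2 <= (2 * g * r) ^+ 2.
      by rewrite ler_pXn2r ?nnegrE//; nra.
    move: h4; rewrite !exprMn g2; nra.
  have h1 : r ^+ 2 < (g * eta * n) ^+ 2.
    by rewrite ltr_pXn2r ?nnegrE// ?mulr_ge0// ltW.
  have h2 : 7 / 8 * eta * n ^+ 2 <= r ^+ 2 by nra.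
  have : 7 / 8 * eta * n ^+ 2 < mu / 3 * eta * (eta * n ^+ 2).
    by rewrite (le_lt_trans h2)// (lt_le_trans h1)// !exprMn g2; lra.
  have en0 : 0 < eta * n ^+ 2 by rewrite mulr_gt0// exprn_gt0.
  rewrite -mulrA ltr_pM2r//; nra.
exists z => //.
have := zmin y; rewrite /phi hz !subrr sqrtr0 add0r.
have -> : enorm (0 : 'rV[R]_d) = 0 by rewrite -(scale0r 0) enormZ// mul0r.
rewrite mulr0 addr0 => h1.
have : (g * enorm (z - y)) ^+ 2 <= Num.sqrt (h y - m) ^+ 2.
  by rewrite ler_pXn2r ?nnegrE ?sqrtr_ge0 ?mulr_ge0 ?enorm_ge0 ?(ltW g0).
rewrite exprMn g2 sqr_sqrtr ?subr_ge0//; lra.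
Qed.

Section MinimaxGeometry.
Variables (R : realType) (d1 d2 : nat) (f : 'rV[R]_d1 * 'rV[R]_d2 -> R).
Variables (l mu : R).
Hypothesis df : forall z, differentiable f z.
Hypothesis lip : lipschitz_gradients l f.
Hypothesis saddle : saddle_point_assumption f.
Hypothesis PL : two_sided_PL mu mu f.
Hypothesis mu0 : 0 < mu.
Hypothesis mul : mu <= l.

Let l0 : 0 < l. Proof. exact: lt_le_trans mul. Qed.

Lemma maxy_attained x : exists y, f (x, y) = maxy f x.
Proof.
have [_ _ /(_ x)[y ymax]] := saddle; exists y; apply/eqP; rewrite eq_le.
rewrite ub_le_sup/=; last first.
- by exists y.
- by exists (f (x, y)) => _ [y' _ <-].
by apply: ge_sup => [|_ [y' _ <-]//]; exists (f (x, y)), y.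
Qed.

Lemma le_maxy z : f z <= maxy f z.1.
Proof.
have [_ _ /(_ z.1)[y ymax]] := saddle.
apply: ub_le_sup; last by exists z.2 => //; case: (z).
by exists (f (z.1, y)) => _ [y' _ <-].
Qed.

(** At the saddle point, [f zs] bounds every [maxy f x] from below through [f (x, zs.2)], and bounds
    [maxy f zs.1] from above. *)
Lemma minimax_saddle : exists2 zs, minimax f = f zs &
  forall x y, f (zs.1, y) <= f zs <= f (x, zs.2).
Proof.
have [[zs Hzs] _ _] := saddle; exists zs => //.
have lb : lbound (range (maxy f)) (f zs).
  move=> _ [x _ <-]; have /andP[_ h] := Hzs x zs.2.
  exact: le_trans h (le_maxy (x, zs.2)).
have [ys ysE] := maxy_attained zs.1.
have /andP[h _] := Hzs zs.1 ys.
apply/eqP; rewrite eq_le; apply/andP; split; last first.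
  by apply: lb_le_inf => //; exists (maxy f zs.1), zs.1.
apply: le_trans h; rewrite ysE; apply: ge_inf; last by exists zs.1.
by exists (f zs).
Qed.

Lemma gap_a_ge0 z : 0 <= gap_a f z.
Proof.
rewrite subr_ge0; have [zs -> Hzs] := minimax_saddle.
have /andP[_ h] := Hzs z.1 zs.2.
exact: le_trans h (le_maxy (z.1, zs.2)).
Qed.

Lemma gap_b_ge0 z : 0 <= gap_b f z.
Proof. by rewrite subr_ge0 le_maxy. Qed.

(** PL in [x] at a maximising [y] becomes PL for the primal function, because
    [minx f y <= f (zs.1, y) <= minimax f] at the saddle point. *)
Lemma max_PL x y : f (x, y) = maxy f x ->
  2 * mu * (maxy f x - minimax f) <= enorm (gradx f (x, y)) ^+ 2.
Proof.
move=> xy; have [h _] := PL (x, y); apply: le_trans h.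
rewrite ler_pM2l ?mulr_gt0// -xy lerD2l lerN2/=.
have [zs -> Hzs] := minimax_saddle; have /andP[h _] := Hzs x y.
apply: le_trans h; have [_ /(_ y)[x0 x0min] _] := saddle.
apply: ge_inf; last by exists zs.1.
by exists (f (x0, y)) => _ [x' _ <-].
Qed.

Let dfx y x : differentiable (fun x => f (x, y)) x.
Proof.
apply: (@differentiable_comp _ _ _ _ (fun x => (x, y)) f); last exact: df.
by apply: differentiable_pair.
Qed.

Let dfy x y : differentiable (fun y => f (x, y)) y.
Proof.
apply: (@differentiable_comp _ _ _ _ (fun y => (x, y)) f); last exact: df.
by apply: differentiable_pair.
Qed.

Let enorm0 d : enorm (0 : 'rV[R]_d) = 0.
Proof. by rewrite -(scale0r 0) enormZ// mul0r. Qed.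

Let lipx y x x' : enorm (grad (fun x => f (x, y)) x - grad (fun x => f (x, y)) x') <=
  l * enorm (x - x').
Proof.
by have [h _] := lip (x, y) (x', y); rewrite /= subrr enorm0 addr0 in h.
Qed.

Let lipy x y y' : enorm (grad (fun y => f (x, y)) y - grad (fun y => f (x, y)) y') <=
  l * enorm (y - y').
Proof.
by have [_ h] := lip (x, y) (x, y'); rewrite /= subrr enorm0 add0r in h.
Qed.

Lemma smoothx_le x y u :
  f (x + u, y) <= f (x, y) + dot (gradx f (x, y)) u + l / 2 * enorm u ^+ 2.
Proof. exact: (smooth_le (dfx y) (lipx y)). Qed.

Lemma smoothx_ge x y u :
  f (x, y) + dot (gradx f (x, y)) u - l / 2 * enorm u ^+ 2 <= f (x + u, y).
Proof. exact: (smooth_ge (dfx y) (lipx y)). Qed.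

Lemma smoothy_ge x y u :
  f (x, y) + dot (grady f (x, y)) u - l / 2 * enorm u ^+ 2 <= f (x, y + u).
Proof. exact: (smooth_ge (dfy x) (lipy x)). Qed.

(** Quadratic growth for the negative of [f] in [y], whose minimum is [- maxy f x]. *)
Lemma argmax_near x y : exists2 y1, f (x, y1) = maxy f x &
  mu * enorm (y1 - y) ^+ 2 <= 3 * gap_b f (x, y).
Proof.
have [||||y1 h1 h2] := @PL_quadratic_growth R d2 (fun y => - f (x, y))
   (fun y => - grady f (x, y)) l mu (- maxy f x) mu0 mul _ _ _ _ y.
- by move=> y'; apply: continuousN; exact: differentiable_continuous.
- by move=> y' u; rewrite dotNl; have := smoothy_ge x y' u; lra.
- by move=> y'; rewrite lerN2; exact: (le_maxy (x, y')).
- move=> y'; have [_ /=] := PL (x, y'); rewrite enormN; lra.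
exists y1; first exact: oppr_inj.
by rewrite /gap_b; move: h2 => /=; lra.
Qed.

(** Otherwise the ascent step [l^-1 *: G] would lift [f] above its maximum by at least
    [enorm G ^+ 2 / (2 * l)]. *)
Lemma grady_argmax x y : f (x, y) = maxy f x -> grady f (x, y) = 0.
Proof.
move=> xy; set G := grady f (x, y).
have := le_trans (smoothy_ge x y (l^-1 *: G)) (le_maxy (x, _)).
rewrite /= -xy dotZr sqr_enormZ -sqr_enorm -/G.
have -> : l / 2 * (l^-1 ^+ 2 * enorm G ^+ 2) = l^-1 * enorm G ^+ 2 / 2.
  by field; rewrite gt_eqF.
move=> h; have li0 : 0 < l^-1 by rewrite invr_gt0.
have G0 : enorm G ^+ 2 <= 0 by rewrite -(ler_pM2l li0); lra.
have {}G0 : enorm G = 0 by apply/eqP; rewrite -sqrf_eq0 eq_le G0 sqr_ge0.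
apply/rowP => i; rewrite [RHS]mxE; apply/eqP; rewrite -normr_le0 -G0.
exact: coord_le_enorm.
Qed.

(* A maximiser y' for x + u lies within 5/4 kappa |u| of y, by quadratic growth
   and PL for f (x + u, .), whose gradient at y is at most l |u|; so the x-gradients
   at (x, y) and (x, y') differ by O(kappa l |u|). *)
Lemma maxy_smooth x y u : f (x, y) = maxy f x ->
  maxy f (x + u) <= maxy f x + dot (gradx f (x, y)) u
                    + 2 * (l ^+ 2 / mu) * enorm u ^+ 2.
Proof.
move=> xy; have [y' y'max y'near] := argmax_near (x + u) y.
set k := enorm (y' - y) in y'near.
have k0 : 0 <= k by exact: enorm_ge0.
have u0 : 0 <= enorm u by exact: enorm_ge0.
have Gu : enorm (grady f (x + u, y)) <= l * enorm u.
  have [_] := lip (x + u, y) (x, y).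
  by rewrite /= (grady_argmax xy) !subr0 subrr enorm0 addr0 addrAC subrr add0r.
(* Quadratic growth and PL give [(mu * k) ^+ 2 <= 3 / 2 * (l * enorm u) ^+ 2], and
   [3 / 2 <= (5 / 4) ^+ 2]. *)
have knear : mu * k <= 5 / 4 * l * enorm u.
  rewrite -(@ler_pXn2r _ 2) ?nnegrE ?mulr_ge0 ?(ltW mu0) ?(ltW l0)//.
  have PLy : 2 * mu * gap_b f (x + u, y) <= enorm (grady f (x + u, y)) ^+ 2.
    by have [] := PL (x + u, y).
  have Gu2 : enorm (grady f (x + u, y)) ^+ 2 <= (l * enorm u) ^+ 2.
    by rewrite ler_pXn2r ?nnegrE ?enorm_ge0 ?mulr_ge0// ltW.
  have := sqr_ge0 (l * enorm u); have := ler_wpM2l (ltW mu0) y'near.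
  rewrite !exprMn in Gu2 *; lra.
have h1 := smoothx_le x y' u.
have h2 := dot_le (gradx f (x, y') - gradx f (x, y)) u.
have [h3 _] := lip (x, y') (x, y).
rewrite /= subrr enorm0 add0r -/k in h3.
have h4 := le_maxy (x, y').
rewrite /= y'max in h1 h4; rewrite dotBl in h2.
have h5 : dot (gradx f (x, y')) u - dot (gradx f (x, y)) u <= l * k * enorm u.
  by apply: le_trans h2 _; exact: ler_wpM2r.
have h6 : l * k * enorm u <= 5 / 4 * (l ^+ 2 / mu) * enorm u ^+ 2.
  rewrite -(ler_pM2l mu0).
  have -> : mu * (5 / 4 * (l ^+ 2 / mu) * enorm u ^+ 2) =
     l * enorm u * (5 / 4 * l * enorm u) by field; rewrite gt_eqF.
  have -> : mu * (l * k * enorm u) = l * enorm u * (mu * k) by ring.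
  by rewrite ler_wpM2l// mulr_ge0// ltW.
(* As [mu <= l], the curvature of [f] is absorbed too; the total [5 / 4 + 1 / 2] is below 2. *)
have h7 : l / 2 * enorm u ^+ 2 <= l ^+ 2 / mu / 2 * enorm u ^+ 2.
  rewrite ler_wpM2r ?sqr_ge0// ler_pM2r// ler_pdivlMr// expr2 ler_pM2l//.
have := sqr_ge0 (enorm u); have : 0 < l ^+ 2 / mu by rewrite divr_gt0// exprn_gt0.
nra.
Qed.

(** This is the bias of following [gradx f z] instead of the gradient of the primal function; it is
    small because a maximiser lies near [z.2]. *)
Lemma gradx_argmax_near z : exists2 y, f (z.1, y) = maxy f z.1 &
  enorm (gradx f (z.1, y) - gradx f z) ^+ 2 <= 3 * (l ^+ 2 / mu) * gap_b f z.
Proof.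
have [y ymax ynear] := argmax_near z.1 z.2.
exists y => //; have [h _] := lip (z.1, y) z.
rewrite /= subrr enorm0 add0r in h.
have : enorm (gradx f (z.1, y) - gradx f z) ^+ 2 <= (l * enorm (y - z.2)) ^+ 2.
  by rewrite ler_pXn2r ?nnegrE ?mulr_ge0 ?enorm_ge0// ltW.
move=> /le_trans; apply; rewrite -surjective_pairing in ynear.
rewrite -(ler_pM2l mu0) exprMn.
have -> : mu * (3 * (l ^+ 2 / mu) * gap_b f z) = l ^+ 2 * (3 * gap_b f z).
  by field; rewrite gt_eqF.
by rewrite mulrCA ler_wpM2l// sqr_ge0.
Qed.

End MinimaxGeometry.

(** The optimality gaps are nonnegative, so PL constants may be lowered; one constant can then serve
    both variables. *)
Lemma two_sided_PL_min (R : realType) (d1 d2 : nat)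
    (f : 'rV[R]_d1 * 'rV[R]_d2 -> R) (mu1 mu2 mu : R) :
  saddle_point_assumption f -> mu <= mu1 -> mu <= mu2 ->
  two_sided_PL mu1 mu2 f -> two_sided_PL mu mu f.
Proof.
move=> saddle le1 le2 PL z; have [h1 h2] := PL z; split.
  apply: le_trans h1; apply: ler_wpM2r; last by rewrite ler_pM2l.
  have [_ /(_ z.2)[x0 x0min] _] := saddle.
  rewrite subr_ge0; apply: ge_inf; last by exists z.1 => //; case: (z).
  by exists (f (x0, z.2)) => _ [x _ <-].
apply: le_trans h2; apply: ler_wpM2r; last by rewrite ler_pM2l.
by rewrite subr_ge0 le_maxy.
Qed.

(** * Averages over finite index sets *)

Section Mean.
Variables (R : realType) (A : finType).
Implicit Types F G : A -> R.

Definition mean F : R := #|A|%:R^-1 * \sum_a F a.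

Lemma meanD F G : mean (fun a => F a + G a) = mean F + mean G.
Proof. by rewrite /mean big_split mulrDr. Qed.

Lemma meanZ c F : mean (fun a => c * F a) = c * mean F.
Proof. by rewrite /mean -mulr_sumr mulrCA. Qed.

Lemma le_mean F G : (forall a, F a <= G a) -> mean F <= mean G.
Proof. by move=> FG; rewrite ler_wpM2l ?invr_ge0//; apply: ler_sum. Qed.

Lemma mean_ge0 F : (forall a, 0 <= F a) -> 0 <= mean F.
Proof. by move=> F0; rewrite mulr_ge0 ?invr_ge0// sumr_ge0. Qed.

Lemma eq_mean F G : F =1 G -> mean F = mean G.
Proof. by move=> FG; congr (_ * _); apply: eq_bigr. Qed.

Lemma mean_sum (I : finType) (F : I -> A -> R) :
  mean (fun a => \sum_i F i a) = \sum_i mean (F i).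
Proof. by rewrite /mean exchange_big mulr_sumr. Qed.

Hypothesis A0 : (0 < #|A|)%N.

Lemma mean_cst c : mean (fun=> c) = c.
Proof.
by rewrite /mean sumr_const -[c *+ _]mulr_natl mulKf// pnatr_eq0 -lt0n.
Qed.

Variable d : nat.
Implicit Types (V : A -> 'rV[R]_d) (w b : 'rV[R]_d).

Definition vmean V : 'rV[R]_d := #|A|%:R^-1 *: \sum_a V a.

Lemma mean_dot V w : mean (fun a => dot w (V a)) = dot w (vmean V).
Proof. by rewrite dotZr dot_sumr. Qed.

Lemma vmeanB V V' : vmean (fun a => V a - V' a) = vmean V - vmean V'.
Proof. by rewrite /vmean sumrB scalerBr. Qed.

Lemma vmeanDr V b : vmean (fun a => V a + b) = vmean V + b.
Proof.
rewrite /vmean big_split/= scalerDr sumr_const -[b *+ _]scaler_nat scalerA.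
by rewrite mulVf ?scale1r// pnatr_eq0 -lt0n.
Qed.

Lemma mean_sqr_enormD V b :
  mean (fun a => enorm (V a + b) ^+ 2) =
  mean (fun a => enorm (V a) ^+ 2) + 2 * dot b (vmean V) + enorm b ^+ 2.
Proof.
rewrite -mean_dot -meanZ -meanD -[X in _ = _ + X]mean_cst -meanD.
by apply: eq_mean => a; rewrite sqr_enormD (dotC b).
Qed.

Lemma sqr_enorm_vmean V : enorm (vmean V) ^+ 2 <= mean (fun a => enorm (V a) ^+ 2).
Proof.
have : 0 <= mean (fun a => enorm (V a + - vmean V) ^+ 2).
  by apply: mean_ge0 => a; exact: sqr_ge0.
by rewrite mean_sqr_enormD enormN dotNl -sqr_enorm; lra.
Qed.

(** Completing the square turns the left side into the right side minus [enorm (vmean V) ^+ 2]. *)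
Lemma mean_sqr_variance_reduced V b :
  mean (fun a => enorm (V a + b) ^+ 2) <=
  mean (fun a => enorm (V a) ^+ 2) + enorm (vmean V + b) ^+ 2.
Proof.
by rewrite mean_sqr_enormD sqr_enormD (dotC b); have := sqr_ge0 (enorm (vmean V)); lra.
Qed.

End Mean.

Lemma mean_pair (R : realType) (A B : finType) (F : A * B -> R) :
  mean F = mean (fun a => mean (fun b => F (a, b))).
Proof.
rewrite /mean -mulr_sumr mulrA card_prod natrM invfM; congr (_ * _).
by rewrite pair_bigA; apply: eq_bigr => -[].
Qed.

Lemma mean_reindex (R : realType) (A B : finType) (g : B -> A) (F : A -> R) :
  bijective g -> mean F = mean (F \o g).
Proof.
move=> bg; rewrite /mean (bij_eq_card bg); congr (_ * _).
by rewrite (reindex g)//; exact: onW_bij.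
Qed.

Section FoldedMean.
Variables (R : realType) (X : Type) (A : finType) (step : X -> A -> X).
Hypothesis A0 : (0 < #|A|)%N.
Implicit Types phi psi : X -> R.

(** Transition operator of the Markov chain driven by uniform draws; its iterates are expectations
    after several draws. *)
Definition mean_step phi (x : X) : R := mean (fun a => phi (step x a)).

Definition ffun_cons m (p : A * {ffun 'I_m -> A}) : {ffun 'I_m.+1 -> A} :=
  [ffun j => if unlift ord0 j is Some j' then p.2 j' else p.1].

Lemma ffun_cons_bij m : bijective (@ffun_cons m).
Proof.
exists (fun i : {ffun 'I_m.+1 -> A} => (i ord0, [ffun j => i (lift ord0 j)])).
  move=> [a i]; rewrite ffunE unlift_none; congr (_, _).
  by apply/ffunP => j; rewrite !ffunE liftK.
move=> i; apply/ffunP => j; rewrite ffunE.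
by case: unliftP => [j'|] ->; rewrite ?ffunE.
Qed.

Lemma codom_ffun_cons m (p : A * {ffun 'I_m -> A}) :
  codom (ffun_cons p) = p.1 :: codom p.2.
Proof.
rewrite /codom /image_mem enum_ordSl/= ffunE unlift_none -map_comp.
by congr (_ :: _); apply: eq_map => j /=; rewrite ffunE liftK.
Qed.

Lemma mean_ffun_cons m (F : {ffun 'I_m.+1 -> A} -> R) :
  mean F = mean (fun a => mean (fun i => F (ffun_cons (a, i)))).
Proof. by rewrite (mean_reindex _ (ffun_cons_bij m)) mean_pair. Qed.

Lemma card_ffun_gt0 m : (0 < #|{: {ffun 'I_m -> A}}|)%N.
Proof. by rewrite card_ffun expn_gt0 A0. Qed.

(** Induction on the first draw: draws before [t] build the state, draw [t] is read by [G], later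
    ones average out. *)
Lemma mean_foldl m (G : X -> A -> R) (x : X) (t : 'I_m) :
  mean (fun i : {ffun 'I_m -> A} => G (foldl step x (take t (codom i))) (i t)) =
  iter t mean_step (fun y => mean (G y)) x.
Proof.
elim: m x t => [|m IH] x t; first by case: t.
rewrite mean_ffun_cons; case: (unliftP ord0 t) => [t'|] ->.
  rewrite lift0 iterS; apply: eq_mean => a; rewrite -IH; apply: eq_mean => i.
  by rewrite codom_ffun_cons/= ffunE liftK.
apply: eq_mean => a /=; rewrite -[RHS](mean_cst (card_ffun_gt0 m)).
by apply: eq_mean => i; rewrite take0 ffunE unlift_none.
Qed.

Lemma mean_foldl_full m phi x :
  mean (fun i : {ffun 'I_m -> A} => phi (foldl step x (codom i))) =
  iter m mean_step phi x.
Proof.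
elim: m x => [|m IH] x.
  rewrite -[RHS](mean_cst (card_ffun_gt0 0)); apply: eq_mean => i.
  by have := size_codom i; rewrite card_ord => /size0nil ->.
rewrite mean_ffun_cons iterS; apply: eq_mean => a; rewrite -IH.
by apply: eq_mean => i; rewrite codom_ffun_cons.
Qed.

Lemma le_mean_step phi psi : (forall x, phi x <= psi x) ->
  forall x, mean_step phi x <= mean_step psi x.
Proof. by move=> h x; apply: le_mean. Qed.

Lemma mean_stepD phi psi x :
  mean_step (fun x => phi x + psi x) x = mean_step phi x + mean_step psi x.
Proof. exact: meanD. Qed.

Lemma le_iter_mean_step m phi psi : (forall x, phi x <= psi x) ->
  forall x, iter m mean_step phi x <= iter m mean_step psi x.
Proof. by move=> h; elim: m => //= m IH; exact: le_mean_step. Qed.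

Lemma iter_mean_stepD m phi psi x :
  iter m mean_step (fun x => phi x + psi x) x =
  iter m mean_step phi x + iter m mean_step psi x.
Proof.
elim: m x => //= m IH x.
by rewrite -mean_stepD; apply: eq_mean => a; rewrite IH.
Qed.

Lemma iter_mean_stepZ m c phi x :
  iter m mean_step (fun x => c * phi x) x = c * iter m mean_step phi x.
Proof.
elim: m x => //= m IH x.
by rewrite -meanZ; apply: eq_mean => a; rewrite IH.
Qed.

(** Telescoping with a time-dependent Lyapunov function: the inequality for the last step is pushed
    through the earlier transitions, which preserve order and sums. *)
Lemma sum_mean_step_le (phi : nat -> X -> R) psi m x :
  (forall j y, (j < m)%N -> mean_step (phi j.+1) y + psi y <= phi j y) ->
  iter m mean_step (phi m) x + \sum_(j < m) iter j mean_step psi x <= phi 0%N x.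
Proof.
elim: m => [_|m IH h]; first by rewrite big_ord0 addr0.
have h1 : iter m.+1 mean_step (phi m.+1) x + iter m mean_step psi x <=
    iter m mean_step (phi m) x.
  by rewrite iterSr -iter_mean_stepD; apply: le_iter_mean_step => y; exact: h.
have h2 := IH (fun j y jm => h j y (ltnW jm)).
by rewrite big_ord_recr/=; rewrite iterS in h1; lra.
Qed.

End FoldedMean.

(** * One variance-reduced step *)

Section Average.
Variables (R : realType) (d1 d2 n : nat).
Variable fs : 'I_n -> 'rV[R]_d1 * 'rV[R]_d2 -> R.
Hypothesis n0 : (0 < n)%N.
Hypothesis dfs : forall i z, differentiable (fs i) z.

Lemma averageE : average fs = n%:R^-1 \*: \sum_(i < n) fs i.
Proof. by apply/funext => z; rewrite /average/= fct_sumE. Qed.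

Lemma differentiable_average z : differentiable (average fs) z.
Proof.
rewrite averageE; apply: differentiableZ.
elim/big_ind : _ => [||i _]; [exact: differentiable_cst | | exact: dfs].
by move=> g h dg dh; exact: differentiableD.
Qed.

Let derive_average (V : normedModType R) (F : 'I_n -> V -> R) x v :
  (forall i, differentiable (F i) x) ->
  'D_v (fun x => n%:R^-1 * \sum_(i < n) F i x) x =
  n%:R^-1 * \sum_(i < n) 'D_v (F i) x.
Proof.
move=> dF.
have -> : (fun x => n%:R^-1 * \sum_(i < n) F i x) = n%:R^-1 \*: \sum_(i < n) F i.
  by apply/funext => y; rewrite /= fct_sumE.
rewrite deriveZ; last first.
  by apply: derivable_sum => i; exact: diff_derivable.
by rewrite derive_sum// => i; exact: diff_derivable.
Qed.

Lemma gradx_average z : gradx (average fs) z = vmean (fun i => gradx (fs i) z).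
Proof.
apply/rowP => j; rewrite !mxE card_ord summxE.
rewrite derive_average; last first.
  move=> i; apply: (@differentiable_comp _ _ _ _ (fun x => (x, z.2)) (fs i)).
    exact: differentiable_pair.
  exact: dfs.
by congr (_ * _); apply: eq_bigr => i _; rewrite mxE.
Qed.

Lemma grady_average z : grady (average fs) z = vmean (fun i => grady (fs i) z).
Proof.
apply/rowP => j; rewrite !mxE card_ord summxE.
rewrite derive_average; last first.
  move=> i; apply: (@differentiable_comp _ _ _ _ (fun y => (z.1, y)) (fs i)).
    exact: differentiable_pair.
  exact: dfs.
by congr (_ * _); apply: eq_bigr => i _; rewrite mxE.
Qed.

Variable l : R.
Hypothesis l0 : 0 <= l.
Hypothesis lip : forall i, lipschitz_gradients l (fs i).

Let card_n : (0 < #|'I_n|)%N. Proof. by rewrite card_ord. Qed.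

Let vmean_le d (V : 'I_n -> 'rV[R]_d) k : 0 <= k ->
  (forall i, enorm (V i) <= k) -> enorm (vmean V) <= k.
Proof.
move=> k0 Vk; rewrite -(@ler_pXn2r _ 2) ?nnegrE ?enorm_ge0//.
apply: le_trans (sqr_enorm_vmean card_n V) _; rewrite -[leRHS](mean_cst card_n).
by apply: le_mean => i; rewrite ler_pXn2r ?nnegrE ?enorm_ge0.
Qed.

Lemma lipschitz_average : lipschitz_gradients l (average fs).
Proof.
move=> z w; rewrite !gradx_average !grady_average -!vmeanB.
have k0 : 0 <= l * (enorm (z.1 - w.1) + enorm (z.2 - w.2)).
  by rewrite mulr_ge0// addr_ge0 ?enorm_ge0.
by split; apply: vmean_le => // i; have [] := lip i z w.
Qed.

Definition sqdist (zt z : 'rV[R]_d1 * 'rV[R]_d2) : R :=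
  enorm (z.1 - zt.1) ^+ 2 + enorm (z.2 - zt.2) ^+ 2.

Let sqr_lip (k a b : R) : 0 <= k -> k <= l * (a + b) ->
  k ^+ 2 <= 2 * l ^+ 2 * (a ^+ 2 + b ^+ 2).
Proof.
move=> k0 h; apply: (@le_trans _ _ ((l * (a + b)) ^+ 2)).
  by rewrite ler_pXn2r ?nnegrE//; exact: le_trans h.
rewrite exprMn [leRHS](_ : _ = l ^+ 2 * (2 * (a ^+ 2 + b ^+ 2))); last by ring.
rewrite ler_wpM2l ?sqr_ge0//.
by have := sqr_ge0 (a - b); lra.
Qed.

(** The estimator is [gradx (fs i) z - gradx (fs i) zt] recentred at the full gradient, so its
    excess second moment is at most the mean square of these differences, which the Lipschitz bound
    controls. *)
Lemma gradx_second_moment zt z :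
  mean (fun i => enorm (gradx (fs i) z - gradx (fs i) zt
                        + gradx (average fs) zt) ^+ 2) <=
  enorm (gradx (average fs) z) ^+ 2 + 2 * l ^+ 2 * sqdist zt z.
Proof.
apply: le_trans (mean_sqr_variance_reduced card_n _ _) _.
rewrite vmeanB -!gradx_average subrK addrC lerD2l -[leRHS](mean_cst card_n).
apply: le_mean => i; have [h _] := lip i z zt.
exact: sqr_lip (enorm_ge0 _) h.
Qed.

Lemma grady_second_moment zt z :
  mean (fun i => enorm (grady (fs i) z - grady (fs i) zt
                        + grady (average fs) zt) ^+ 2) <=
  enorm (grady (average fs) z) ^+ 2 + 2 * l ^+ 2 * sqdist zt z.
Proof.
apply: le_trans (mean_sqr_variance_reduced card_n _ _) _.
rewrite vmeanB -!grady_average subrK addrC lerD2l -[leRHS](mean_cst card_n).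
apply: le_mean => i; have [_ h] := lip i z zt.
exact: sqr_lip (enorm_ge0 _) h.
Qed.

Lemma gradx_unbiased zt z :
  vmean (fun i => gradx (fs i) z - gradx (fs i) zt + gradx (average fs) zt) =
  gradx (average fs) z.
Proof. by rewrite vmeanDr// vmeanB -!gradx_average subrK. Qed.

Lemma grady_unbiased zt z :
  vmean (fun i => grady (fs i) z - grady (fs i) zt + grady (average fs) zt) =
  grady (average fs) z.
Proof. by rewrite vmeanDr// vmeanB -!grady_average subrK. Qed.

End Average.

Local Ltac nneg := repeat first
  [ assumption | exact: ler0n | exact: ler01 | (apply: ltW; assumption)
  | exact: sqr_ge0 | rewrite invr_ge0 | apply: exprn_ge0 | apply: mulr_ge0
  | apply: addr_ge0 ].

Lemma small_powers (R : realType) (u : R) : 0 < u -> u <= 1 / 100 ->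
  [/\ u ^+ 2 <= u / 100, u ^+ 3 <= u ^+ 2 / 100 & u ^+ 4 <= u ^+ 3 / 100].
Proof.
move=> u0 u1.
have h k : u ^+ k.+1 <= u ^+ k / 100.
  by rewrite exprSr ler_wpM2l ?exprn_ge0 ?(ltW u0)//; lra.
by split => //; have := h 1%N; rewrite expr1.
Qed.

(* u stands for beta^(1/2) / n^(1/3) and w for 1 / kappa. *)
Lemma y_step_arith (R : realType) (l u w c X Y B W M dt : R) :
  0 < l -> 0 < u -> u <= 1 / 100 -> 0 < w -> 0 <= c -> c <= u / 400 ->
  0 <= X -> 0 <= Y -> 0 <= B -> 2 * w * B <= W -> M <= W + 2 * l * (X + Y) ->
  2 * dt <= W / u + l * u * Y ->
  1 / 20 * (B - u ^+ 2 * W + u ^+ 4 / 2 * M) +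
  l * c * (X + Y) + 2 * c * u ^+ 2 * dt + c * u ^+ 4 * M <=
  1 / 20 * (1 - 9 / 5 * u ^+ 2 * w) * B +
  l * (c * (1 + u ^+ 3 + 2 * u ^+ 4) + u ^+ 4 / 20) * (X + Y).
Proof.
(* [B] is the gap, [X] and [Y] are squared distances to the snapshot, [dt] pairs the [y]
   displacement with the gradient; [W] and [M] are the squared gradient and the second moment of its
   estimator, both divided by [l]. *)
move=> l0 u0 u1 w0 c0 cu X0 Y0 B0 BW MW dtW.
have [u2_le u3_le u4_le] := small_powers u0 u1.
have W0 : 0 <= W by apply: le_trans BW; nneg.
have h1 : c * u ^+ 2 * (2 * dt) <= c * u * W + l * c * u ^+ 3 * (X + Y).
  apply: (@le_trans _ _ (c * u ^+ 2 * (W / u + l * u * Y))).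
    by rewrite ler_wpM2l//; nneg.
  have -> : c * u ^+ 2 * (W / u + l * u * Y) = c * u * W + l * c * u ^+ 3 * Y.
    by field; rewrite gt_eqF.
  by rewrite lerD2l ler_wpM2l ?lerDr//; nneg.
have u40 : 0 <= u ^+ 4 by nneg.
have h2 : (u ^+ 4 / 40 + c * u ^+ 4) * M <=
    (u ^+ 4 / 40 + c * u ^+ 4) * (W + 2 * l * (X + Y)).
  by rewrite ler_wpM2l//; nneg.
have h3 : c * u <= u ^+ 2 / 400.
  by have := ler_wpM2r (ltW u0) cu; lra.
have h4 : u ^+ 4 <= u ^+ 2 / 100 by clear -u2_le u3_le u4_le u0; have := sqr_ge0 u; lra.
have h5 : c * u ^+ 4 <= u ^+ 4 / 10.
  by rewrite [leRHS]mulrC; apply: ler_wpM2r => //; lra.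
(* Nine tenths of the ascent term [u ^+ 2 / 20 * W] survive; PL turns them into the rate
   [9 / 5 * u ^+ 2 * w] on [1 / 20 * B]. *)
have h6 : (u ^+ 4 / 40 + c * u ^+ 4 + c * u - u ^+ 2 / 20) * W <=
   - (9 / 200 * u ^+ 2) * W.
  by apply: (ler_wpM2r W0); have := sqr_ge0 u; clear -h3 h4 h5; lra.
have h7 : 9 / 200 * u ^+ 2 * (2 * w * B) <= 9 / 200 * u ^+ 2 * W.
  by rewrite ler_wpM2l//; nneg.
clear -h1 h2 h6 h7; lra.
Qed.

(** [P], [Q] and [pq] are the squared norms and inner product of the primal gradient and [gradx f],
    and [r] is their squared distance. In [pq = (P + Q - r) / 2], the [P] part contracts [a] by PL,
    the [Q] part pays for noise and drift, and [r] costs a multiple of [u ^+ 2 * w * b]. *)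
Lemma x_step_arith (R : realType) (l u w c e P Q r pq a b D X dx M t b' : R) :
  0 < l -> 0 < u -> u <= 1 / 100 -> 0 < w -> w <= 1 ->
  0 <= c -> c <= u / 400 -> e = c * (1 + u ^+ 3 + 2 * u ^+ 4) + u ^+ 4 / 20 ->
  0 <= P -> 0 <= Q -> 0 <= a -> 0 <= b -> 0 <= X -> X <= D ->
  0 <= r -> r = P - 2 * pq + Q -> r <= 3 * (l / w) * b -> 2 * (l * w) * a <= P ->
  0 <= M -> M <= Q + 2 * l ^+ 2 * D -> - 2 * dx <= Q / (l * u) + l * u * X ->
  t = u ^+ 2 * w ^+ 2 / (28 * l) -> b' = 1 / 20 * (1 - 9 / 5 * u ^+ 2 * w) ->
  a - t * pq + 2 * (l / w) * t ^+ 2 * M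
  + b' * (b - t * pq + t * Q + (2 * (l / w) + l / 2) * t ^+ 2 * M)
  + l * e * (D - 2 * t * dx + t ^+ 2 * M) <=
  (1 - u ^+ 2 * w ^+ 3 / 28) * (a + 1 / 20 * b) + l * (c + u ^+ 4 / 5) * D.
Proof.
move=> l0 u0 u1 w0 w1 c0 cu eE P0 Q0 a0 b0 X0 XD r0 rE rb Pa M0 MQ dxQ tE b'E.
have [u2_le u3_le u4_le] := small_powers u0 u1.
have t0 : 0 < t by rewrite tE divr_gt0 ?mulr_gt0 ?exprn_gt0.
have D0 : 0 <= D by exact: le_trans XD.
have lt_ : l * t = u ^+ 2 * w ^+ 2 / 28 by rewrite tE; field; rewrite gt_eqF.
have kt : l / w * t = u ^+ 2 * w / 28 by rewrite tE; field; rewrite !gt_eqF.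
set k := l / w in rb kt *.
have lk : l <= k by rewrite ler_pdivlMr// ler_piMr// ltW.
have u21 : u ^+ 2 <= 1 / 100 by lra.
have u20 : 0 < u ^+ 2 by rewrite exprn_gt0.
have u30 : 0 < u ^+ 3 by rewrite exprn_gt0.
have u40 : 0 < u ^+ 4 by rewrite exprn_gt0.
have e0 : 0 <= e.
  by rewrite eE; nneg.
have ec : e <= c + u ^+ 4 / 15 by rewrite eE; nra.
have eu : e <= u / 100 by lra.
have b'0 : 0 <= b'.
  have : u ^+ 2 * w <= 1 / 100 by nra.
  by rewrite b'E; lra.
have b'1 : b' <= 1 / 20.
  have : 0 <= u ^+ 2 * w by nneg.
  by rewrite b'E; lra.
have ktM : k * t ^+ 2 * M <= t * Q / 100 + l * u ^+ 4 / 14 / 28 * D.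
  apply: (@le_trans _ _ (k * t ^+ 2 * (Q + 2 * l ^+ 2 * D))).
    by rewrite ler_wpM2l// /k; nneg.
  have -> : k * t ^+ 2 * (Q + 2 * l ^+ 2 * D) =
      (k * t) * t * Q + 2 * l * (k * t) * (l * t) * D by ring.
  rewrite kt lt_; apply: lerD.
    have : u ^+ 2 * w / 28 <= 1 / 100 by nra.
    have : 0 <= t * Q by nneg.
    nra.
  have -> : 2 * l * (u ^+ 2 * w / 28) * (u ^+ 2 * w ^+ 2 / 28) * D =
     (l * u ^+ 4 / 14 / 28 * D) * w ^+ 3 by field.
  by apply: ler_piMr; [nneg | apply: exprn_ile1; nneg].
have noise : 2 * k * t ^+ 2 * M + b' * ((2 * k + l / 2) * t ^+ 2 * M)
    + l * e * (t ^+ 2 * M) <= 11 / 5 * (k * t ^+ 2 * M).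
  have tM : 0 <= t ^+ 2 * M by nneg.
  have : 2 * k + b' * (2 * k + l / 2) + l * e <= 11 / 5 * k.
    have : b' * (2 * k + l / 2) <= 1 / 20 * (2 * k + l / 2).
      by apply: ler_wpM2r => //; lra.
    have : l * e <= l * (1 / 100) by rewrite ler_wpM2l ?ltW//; lra.
    lra.
  by move=> /(ler_wpM2r tM); lra.
have cross : l * e * (- 2 * t * dx) <= t * Q / 100 + l * u ^+ 4 / 100 * D.
  apply: (@le_trans _ _ (l * e * t * (Q / (l * u) + l * u * X))).
    have -> : l * e * (- 2 * t * dx) = l * e * t * (- 2 * dx) by ring.
    by rewrite ler_wpM2l//; nneg.
  have -> : l * e * t * (Q / (l * u) + l * u * X) =
      e / u * (t * Q) + l * e * u * (l * t) * X by field; rewrite !gt_eqF.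
  apply: lerD.
    have : e / u <= 1 / 100 by rewrite ler_pdivrMr//; lra.
    have : 0 <= t * Q by nneg.
    nra.
  rewrite lt_.
  have h1 : e * u * (u ^+ 2 * w ^+ 2 / 28) <= u ^+ 4 / 100.
    have -> : e * u * (u ^+ 2 * w ^+ 2 / 28) = e * u ^+ 3 / 28 * w ^+ 2 by field.
    apply: (@le_trans _ _ (e * u ^+ 3 / 28)).
      by apply: ler_piMr; [nneg | apply: exprn_ile1; nneg].
    have := ler_wpM2r (ltW u30) eu.
    have -> : u / 100 * u ^+ 3 = u ^+ 4 / 100 by field.
    lra.
  have h2 : l * (e * u * (u ^+ 2 * w ^+ 2 / 28)) * X <= l * (u ^+ 4 / 100) * D.
    apply: ler_pM; [nneg | exact: X0 | | exact: XD].
    exact: (ler_wpM2l (ltW l0) h1).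
  lra.
(* The bias is charged [1 / 2] through [a] and [1 / 40] through [b']. The factor [w ^+ 2 / 28] in
   [t] keeps the cost [9 / 160] below the gain [9 / 100] contained in [b']. *)
have rt : (1 / 2 + 1 / 40) * (t * r) <= 9 / 160 * (u ^+ 2 * w) * b.
  have := ler_wpM2l (ltW t0) rb.
  have -> : t * (3 * k * b) = 3 * (k * t) * b by ring.
  rewrite kt; lra.
have Pt : 2 * (u ^+ 2 * w ^+ 3 / 28) * a <= t * P.
  have -> : 2 * (u ^+ 2 * w ^+ 3 / 28) * a = t * (2 * (l * w) * a).
    by rewrite tE; field; rewrite gt_eqF.
  exact: ler_wpM2l (ltW t0) _ _ Pa.
have bb : b' * b + 9 / 160 * (u ^+ 2 * w) * b <=
    (1 - u ^+ 2 * w ^+ 3 / 28) * (1 / 20 * b).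
  rewrite b'E.
  have w3 : u ^+ 2 * w ^+ 3 <= u ^+ 2 * w.
    apply: ler_wpM2l; first by nneg.
    by rewrite exprS; apply: ler_piMr; [nneg | apply: exprn_ile1; nneg].
  have := ler_wpM2r b0 w3.
  have : 0 <= u ^+ 2 * w * b by nneg.
  lra.
have pqE : pq = (P + Q - r) / 2 by rewrite rE; field.
have b'r : b' * (t * (Q - pq)) <= 1 / 40 * (t * r) + 1 / 40 * (t * Q).
  apply: (@le_trans _ _ (1 / 20 * (t * ((Q + r) / 2)))); last by lra.
  apply: (@le_trans _ _ (b' * (t * ((Q + r) / 2)))).
    by rewrite ler_wpM2l// ler_wpM2l ?(ltW t0)//; lra.
  by rewrite ler_wpM2r// mulr_ge0 ?(ltW t0)//; lra.
have ecD : l * e * D <= l * (c + u ^+ 4 / 15) * D.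
  apply: ler_wpM2r D0 _ _ _; exact: ler_wpM2l (ltW l0) _ _ ec.
have lD : 0 <= l * u ^+ 4 * D by nneg.
have tQ : 0 <= t * Q by nneg.
have tpq : t * pq = (t * P + t * Q - t * r) / 2 by rewrite pqE; field.
clear -tpq tQ lD ecD b'r bb Pt rt cross noise ktM; lra.
Qed.

(** [vr_x] and [vr_y] split [vr_step] into half-steps, the second starting from the new [x], so that
    the two indices can be averaged separately. *)
Definition vr_x (R : realType) (d1 d2 n : nat)
    (fs : 'I_n -> 'rV[R]_d1 * 'rV[R]_d2 -> R) (tau1 : R) zt z (i : 'I_n) :=
  z.1 - tau1 *: (gradx (fs i) z - gradx (fs i) zt + gradx (average fs) zt).

Definition vr_y (R : realType) (d1 d2 n : nat)
    (fs : 'I_n -> 'rV[R]_d1 * 'rV[R]_d2 -> R) (tau2 : R) zt x y (i : 'I_n) :=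
  (x, y + tau2 *: (grady (fs i) (x, y) - grady (fs i) zt + grady (average fs) zt)).

Section OneStep.
Variables (R : realType) (d1 d2 n : nat).
Local Notation point := ('rV[R]_d1 * 'rV[R]_d2)%type.
Variables (fs : 'I_n -> point -> R) (l mu u : R).
Hypothesis n0 : (0 < n)%N.
Hypothesis dfs : forall i z, differentiable (fs i) z.
Hypothesis lip : forall i, lipschitz_gradients l (fs i).
Local Notation f := (average fs).
Hypothesis saddle : saddle_point_assumption f.
Hypothesis PL : two_sided_PL mu mu f.
Hypothesis mu0 : 0 < mu.
Hypothesis mul : mu <= l.
Hypothesis u0 : 0 < u.
Hypothesis u1 : u <= 1 / 100.

Let l0 : 0 < l. Proof. exact: lt_le_trans mul. Qed.
Let df z : differentiable f z. Proof. exact: differentiable_average. Qed.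
Let lipf : lipschitz_gradients l f.
Proof. exact: lipschitz_average (ltW l0) lip. Qed.
Let card_n : (0 < #|'I_n|)%N. Proof. by rewrite card_ord. Qed.

Let w := mu / l.
Let w0 : 0 < w. Proof. exact: divr_gt0. Qed.
Let w1 : w <= 1. Proof. by rewrite ler_pdivrMr// mul1r. Qed.
Let lw : l * w = mu. Proof. by rewrite mulrC divfK// gt_eqF. Qed.

Let mean_affine d (V : 'I_n -> 'rV[R]_d) K h k :
  mean (fun i => K + dot h (V i) + k * enorm (V i) ^+ 2) =
  K + dot h (vmean V) + k * mean (fun i => enorm (V i) ^+ 2).
Proof. by rewrite !meanD mean_cst// mean_dot meanZ. Qed.

Let young (d : nat) (a b : 'rV[R]_d) :
  2 * dot a b <= enorm b ^+ 2 / (l * u) + l * u * enorm a ^+ 2.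
Proof. by rewrite dotC; apply: dot_young; rewrite mulr_gt0. Qed.

(** The [y] half-step leaves [maxy f x] alone, so only the ascent of [f] and the drift from the
    snapshot count. *)
Lemma y_step_le zt x y (c tau2 : R) : 0 <= c -> c <= u / 400 -> tau2 = u ^+ 2 / l ->
  mean (fun i => 1 / 20 * gap_b f (vr_y fs tau2 zt x y i)
                 + l * c * sqdist zt (vr_y fs tau2 zt x y i)) <=
  1 / 20 * (1 - 9 / 5 * u ^+ 2 * w) * gap_b f (x, y)
  + l * (c * (1 + u ^+ 3 + 2 * u ^+ 4) + u ^+ 4 / 20) * sqdist zt (x, y).
Proof.
move=> c0 cu tau2E.
pose v i := grady (fs i) (x, y) - grady (fs i) zt + grady f zt.
pose g := grady f (x, y).
pose dy := y - zt.2.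
(* [h] and [k] collect the linear and quadratic coefficients of the estimator [v i], so that only
   its mean and second moment enter. *)
pose h := (- (1 / 20 * tau2)) *: g + (2 * l * c * tau2) *: dy.
have hE z : dot h z = - (1 / 20 * tau2) * dot g z + 2 * l * c * tau2 * dot dy z.
  by rewrite /h dotDl !dotZl.
pose k := 1 / 20 * (l / 2 * tau2 ^+ 2) + l * c * tau2 ^+ 2.
apply: (@le_trans _ _ (mean (fun i =>
  1 / 20 * gap_b f (x, y) + l * c * sqdist zt (x, y) +
  dot h (v i) +
  k * enorm (v i) ^+ 2))).
  apply: le_mean => i; rewrite /vr_y -/(v i).
  have h1 := smoothy_ge df lipf x y (tau2 *: v i).
  rewrite -/g dotZr sqr_enormZ in h1.
  have h2 : enorm (y + tau2 *: v i - zt.2) ^+ 2 =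
      enorm dy ^+ 2 + 2 * tau2 * dot dy (v i) + tau2 ^+ 2 * enorm (v i) ^+ 2.
    by rewrite addrAC -/dy sqr_enormD dotZr sqr_enormZ; ring.
  rewrite /gap_b /sqdist/= h2 hE -/dy /k; lra.
rewrite mean_affine /v grady_unbiased// -/g.
have := grady_second_moment n0 dfs lip zt (x, y); rewrite -/g.
set M := mean _ => hM.
have := @y_step_arith R l u w c (enorm (x - zt.1) ^+ 2) (enorm dy ^+ 2)
  (gap_b f (x, y)) (enorm g ^+ 2 / l) (M / l) (dot dy g) l0 u0 u1 w0 c0 cu
  (sqr_ge0 _) (sqr_ge0 _).
have -> : enorm (x - zt.1) ^+ 2 + enorm dy ^+ 2 = sqdist zt (x, y) by [].
move=> hy; apply: le_trans (hy _ _ _ _).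
- rewrite hE -sqr_enorm /k tau2E le_eqVlt; apply/orP; left; apply/eqP.
  by field; rewrite gt_eqF.
- exact: (gap_b_ge0 saddle).
- have [_ h2] := PL (x, y).
  rewrite ler_pdivlMr// mulrAC -[2 * w * l]mulrA [w * l]mulrC lw; exact: h2.
- rewrite ler_pdivrMr// mulrDl divfK ?gt_eqF//; apply: le_trans hM _.
  by rewrite lerD2l le_eqVlt; apply/orP; left; apply/eqP; ring.
- apply: le_trans (young _ _) _; rewrite lerD2r -mulrA -invfM; exact: lexx.
Qed.

(** [b'] and [e] are the weights that [y_step_le] puts on the gap and the distance, so the
    half-steps compose. [maxy_smooth] bounds the new maximum from above and [smoothx_ge] the new
    value of [f] from below. *)
Lemma x_step_le zt z (c e b' tau1 : R) : 0 <= c -> c <= u / 400 ->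
  e = c * (1 + u ^+ 3 + 2 * u ^+ 4) + u ^+ 4 / 20 ->
  b' = 1 / 20 * (1 - 9 / 5 * u ^+ 2 * w) -> 0 <= b' -> 0 <= e ->
  tau1 = u ^+ 2 * w ^+ 2 / (28 * l) ->
  mean (fun i => gap_a f (vr_x fs tau1 zt z i, z.2)
                 + (b' * gap_b f (vr_x fs tau1 zt z i, z.2)
                 + l * e * sqdist zt (vr_x fs tau1 zt z i, z.2))) <=
  (1 - u ^+ 2 * w ^+ 3 / 28) * initial_potential f z
  + l * (c + u ^+ 4 / 5) * sqdist zt z.
Proof.
move=> c0 cu eE b'E b'0 e0 tau1E.
pose v i := gradx (fs i) z - gradx (fs i) zt + gradx f zt.
have [y1 y1max y1near] := gradx_argmax_near df lipf saddle PL mu0 mul z.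
have kE : l / w = l ^+ 2 / mu by rewrite /w; field; rewrite !gt_eqF.
pose q := gradx f z.
pose p := gradx f (z.1, y1).
pose dx := z.1 - zt.1.
pose k := (1 + b') * (2 * (l ^+ 2 / mu) * tau1 ^+ 2) + b' * (l / 2 * tau1 ^+ 2)
  + l * e * tau1 ^+ 2.
pose h := (- ((1 + b') * tau1)) *: p + (b' * tau1) *: q + (- (2 * l * e * tau1)) *: dx.
have hE y : dot h y = - ((1 + b') * tau1) * dot p y + b' * tau1 * dot q y
    - 2 * l * e * tau1 * dot dx y.
  by rewrite /h 2!dotDl 3!dotZl; ring.
apply: (@le_trans _ _ (mean (fun i =>
  gap_a f z + (b' * gap_b f z + l * e * sqdist zt z) + dot h (v i) +
  k * enorm (v i) ^+ 2))).
  apply: le_mean => i; rewrite /vr_x -/(v i).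
  have := maxy_smooth df lipf saddle PL mu0 mul (- (tau1 *: v i)) y1max.
  have := smoothx_ge df lipf z.1 z.2 (- (tau1 *: v i)).
  rewrite -surjective_pairing -/q -/p !dotNr !dotZr enormN sqr_enormZ => h1 h2.
  have h3 : enorm (z.1 - tau1 *: v i - zt.1) ^+ 2 =
      enorm dx ^+ 2 - 2 * tau1 * dot dx (v i) + tau1 ^+ 2 * enorm (v i) ^+ 2.
    by rewrite addrAC -/dx sqr_enormB dotZr sqr_enormZ; ring.
  rewrite /gap_a /gap_b /sqdist/= h3 hE -/dx /k.
  have b1 : 0 <= 1 + b' by apply: addr_ge0.
  have {}h1 := ler_wpM2l b'0 h1; have {}h2 := ler_wpM2l b1 h2.
  lra.
rewrite mean_affine /v gradx_unbiased// -/q.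
have := gradx_second_moment n0 dfs lip zt z; rewrite -/q.
set M := mean _ => hM.
have M0 : 0 <= M by apply: mean_ge0 => i; exact: sqr_ge0.
have XD : enorm dx ^+ 2 <= sqdist zt z by rewrite lerDl sqr_ge0.
have rE : enorm (p - q) ^+ 2 = enorm p ^+ 2 - 2 * dot p q + enorm q ^+ 2.
  by rewrite sqr_enormB.
have hr : enorm (p - q) ^+ 2 <= 3 * (l / w) * gap_b f z by rewrite kE.
have hP : 2 * (l * w) * gap_a f z <= enorm p ^+ 2.
  by rewrite lw; exact: (max_PL saddle PL).
have hd : - 2 * dot dx q <= enorm q ^+ 2 / (l * u) + l * u * enorm dx ^+ 2.
  by rewrite mulNr -mulrN -dotNl -(enormN dx); exact: young.
have := x_step_arith l0 u0 u1 w0 w1 c0 cu eE (sqr_ge0 _) (sqr_ge0 _)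
  (gap_a_ge0 saddle z) (gap_b_ge0 saddle z) (sqr_ge0 _) XD (sqr_ge0 _) rE hr hP M0 hM
  hd tau1E b'E.
rewrite -/(initial_potential f z); apply: le_trans.
rewrite hE -sqr_enorm /k kE le_eqVlt; apply/orP; left; apply/eqP.
by field; rewrite gt_eqF.
Qed.

(** Average over the [y] index with the [x] index fixed, then over the [x] index. *)
Lemma vr_step_le zt z (c tau1 tau2 : R) : 0 <= c -> c <= u / 400 ->
  tau1 = u ^+ 2 * w ^+ 2 / (28 * l) -> tau2 = u ^+ 2 / l ->
  mean (fun i => initial_potential f (vr_step fs tau1 tau2 zt z i)
                 + l * c * sqdist zt (vr_step fs tau1 tau2 zt z i)) <=
  (1 - u ^+ 2 * w ^+ 3 / 28) * initial_potential f z
  + l * (c + u ^+ 4 / 5) * sqdist zt z.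
Proof.
move=> c0 cu tau1E tau2E.
pose e := c * (1 + u ^+ 3 + 2 * u ^+ 4) + u ^+ 4 / 20.
pose b' := 1 / 20 * (1 - 9 / 5 * u ^+ 2 * w).
have e0 : 0 <= e.
  by rewrite addr_ge0 ?divr_ge0 ?mulr_ge0 ?addr_ge0 ?mulr_ge0 ?exprn_ge0 ?(ltW u0).
have b'0 : 0 <= b'.
  have : u ^+ 2 * w <= 1 / 100 * 1.
    apply: ler_pM; rewrite ?sqr_ge0 ?(ltW w0)//.
    by have [h _ _] := small_powers u0 u1; have := u1; lra.
  by rewrite /b' => h; lra.
apply: le_trans (x_step_le zt z c0 cu erefl erefl b'0 e0 tau1E).
rewrite mean_pair; apply: le_mean => i1.
set x := vr_x _ _ _ _ _.
apply: (@le_trans _ _ (gap_a f (x, z.2) +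
  mean (fun i => 1 / 20 * gap_b f (vr_y fs tau2 zt x z.2 i)
                 + l * c * sqdist zt (vr_y fs tau2 zt x z.2 i)))).
  rewrite -[X in _ <= X + _](mean_cst card_n) -meanD.
  by apply: le_mean => i2; rewrite addrA.
by rewrite lerD2l; exact: y_step_le.
Qed.

End OneStep.

(** * One epoch *)

Section Epoch.
Variables (R : realType) (d1 d2 n : nat).
Local Notation point := ('rV[R]_d1 * 'rV[R]_d2)%type.
Variables (fs : 'I_n -> point -> R) (tau1 tau2 : R) (N T : nat).
Hypothesis n0 : (0 < n)%N.
Local Notation inner := (inner_iterate fs tau1 tau2).
Local Notation loop := {ffun 'I_N -> 'I_n * 'I_n}.
Implicit Types (phi : point -> R) (z zt : point).

Let pairs0 : (0 < #|{: 'I_n * 'I_n}|)%N.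
Proof. by rewrite card_prod card_ord muln_gt0 n0. Qed.

Let loops0 : (0 < #|{: loop}|)%N. Proof. exact: card_ffun_gt0. Qed.

Lemma mean_inner_iterate phi zt (j : 'I_N) :
  mean (fun i : loop => phi (inner zt i j)) =
  iter j (mean_step (vr_step fs tau1 tau2 zt)) phi zt.
Proof.
(* [mean_foldl] observes the state with the current draw, so a function of the state alone is
   written as a constant average over that draw. *)
have -> : phi = fun y => mean (fun _ : 'I_n * 'I_n => phi y).
  by apply/funext => y; rewrite mean_cst.
rewrite -(mean_foldl (vr_step fs tau1 tau2 zt) pairs0 (fun y _ => phi y) zt j).
by apply: eq_mean => i; rewrite mean_cst.
Qed.

Lemma mean_inner_loop phi zt :
  mean (fun i : loop => phi (inner zt i N)) =
  iter N (mean_step (vr_step fs tau1 tau2 zt)) phi zt.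
Proof.
rewrite -mean_foldl_full//; apply: eq_mean => i.
by rewrite /inner_iterate take_oversize// size_codom card_ord.
Qed.

Lemma snapshotE z0 (i : {ffun 'I_T -> loop}) t :
  snapshot fs tau1 tau2 z0 (fun t => i t) t =
  foldl (fun zt (it : loop) => inner zt it N) z0 (take t (codom i)).
Proof.
rewrite /snapshot.
have -> : codom (fun t => fun_of_fin (i t)) =
    map (fun it : loop => fun_of_fin it) (codom i).
  by rewrite /codom /image_mem -map_comp.
by rewrite -map_take; elim: (take t _) z0 => //= a s IH z0.
Qed.

Definition mean_epoch phi z :=
  mean (fun p : {ffun 'I_T -> loop} * ('I_T * 'I_N) =>
    phi (epoch fs tau1 tau2 z (fun t => p.1 t) p.2)).

Variables (pot : point -> R) (Phi : point -> nat -> point -> R) (r : R).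
Hypothesis pot_ge0 : forall z, 0 <= pot z.
Hypothesis pot_step : forall zt j z, (j < N)%N ->
  mean_step (vr_step fs tau1 tau2 zt) (Phi zt j.+1) z + r * pot z <= Phi zt j z.
Hypothesis Phi0 : forall zt, Phi zt 0%N zt = pot zt.
Hypothesis PhiN : forall zt z, Phi zt N z = pot z.

(** [Phi0] and [PhiN] make the Lyapunov function agree with [pot] at both ends of the loop, so
    telescoping leaves an inequality in [pot] alone that can be telescoped again over snapshots. *)
Lemma inner_loop_le zt :
  mean_step (fun zt (i : loop) => inner zt i N) pot zt +
  mean (fun i : loop => \sum_(j < N) r * pot (inner zt i j)) <= pot zt.
Proof.
have := sum_mean_step_le zt (@pot_step zt).
rewrite Phi0; apply: le_trans; apply: lerD.
  rewrite -mean_inner_loop /mean_step; apply: le_mean => i.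
  by rewrite PhiN.
rewrite mean_sum; apply: ler_sum => j _.
by rewrite (mean_inner_iterate (fun z => r * pot z)).
Qed.

(** The sum over all iterates is [T * N] times [mean_epoch], the output being uniform among them;
    the last potential in the telescoping over [t] is nonnegative and dropped. *)
Lemma epoch_sum_le z0 : (0 < N)%N -> (0 < T)%N ->
  r * (T%:R * N%:R) * mean_epoch pot z0 <= pot z0.
Proof.
move=> N0 T0; pose psi zt := mean (fun i : loop => \sum_(j < N) r * pot (inner zt i j)).
have := @sum_mean_step_le R _ _ (fun zt (i : loop) => inner zt i N)
  (fun _ => pot) psi T z0 (fun _ zt _ => inner_loop_le zt).
have h0 : 0 <= iter T (mean_step (fun zt (i : loop) => inner zt i N)) pot z0.
  elim: T z0 => //= t IH z0; apply: mean_ge0 => i; exact: IH.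
apply: le_trans; apply: (@le_trans _ _ (\sum_(t < T)
    iter t (mean_step (fun zt (i : loop) => inner zt i N)) psi z0)); last first.
  by rewrite lerDr.
under eq_bigr => t _ do
  rewrite /psi -(mean_foldl (fun zt (i : loop) => inner zt i N) loops0
    (fun zt i => \sum_(j < N) r * pot (inner zt i j)) z0 t).
rewrite -mean_sum /mean_epoch mean_pair -meanZ; apply: le_mean => i.
rewrite /mean card_prod !card_ord natrM.
rewrite -[X in X <= _]mulrA mulVKf ?mulf_neq0 ?pnatr_eq0 -?lt0n// mulr_sumr.
rewrite pair_bigA/=; apply: ler_sum => -[t j] _ /=.
by rewrite /epoch/= snapshotE.
Qed.

End Epoch.

(** * From random draws to averages *)

Section FiniteUniform.
Local Open Scope ereal_scope.
Variables (R : realType) (d : measure_display) (Omega : measurableType d).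
Variables (P : probability Omega R) (V : finType) (Y : Omega -> V) (p : \bar R).
Hypothesis mY : forall v, measurable [set w | Y w = v].
Hypothesis PY : forall v, P [set w | Y w = v] = p.

Let expectation_finite (phi : V -> R) : (forall v, 0 <= phi v)%R ->
  'E_P[phi \o Y] = \sum_v (phi v)%:E * p.
Proof.
move=> phi0; rewrite unlock.
have E w : (phi (Y w))%:E = \sum_v (phi v)%:E * (\1_[set w | Y w = v] w)%:E.
  rewrite (bigD1 (Y w))//= big1 => [|v vw].
    by rewrite adde0 indicE mem_set// mule1.
  by rewrite indicE memNset ?mule0//=; apply/eqP; rewrite eq_sym.
under eq_integral => w _ do rewrite /= E.
have m1 v : measurable_fun [set: Omega] (fun w => (\1_[set w | Y w = v] w)%:E : \bar R).
  by apply/measurable_EFinP; exact: measurable_indic.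
rewrite ge0_integral_sum//.
- apply: eq_bigr => v _.
  have i0 w : [set: Omega] w -> 0 <= (\1_[set w | Y w = v] w : R)%:E.
    by rewrite lee_fin.
  rewrite ge0_integralZl_EFin ?phi0// integral_indic// setIT.
  by congr (_ * _); exact: PY.
- by move=> v; apply: emeasurable_funM.
- by move=> v w _; rewrite mule_ge0// lee_fin.
Qed.

(** The constant function 1 shows that [p] sums to 1 over [V], which excludes an empty [V] and
    determines [p]. *)
Lemma expectation_uniform (phi : V -> R) : (forall v, 0 <= phi v)%R ->
  'E_P[phi \o Y] = (mean phi)%:E.
Proof.
have p1 : \sum_(v : V) p = 1.
  have := @expectation_finite (fun=> 1%R) (fun _ => ler01).
  rewrite [X in 'E_P[X]](_ : _ = cst 1%R)// expectation_cst => ->.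
  by apply: eq_bigr => v _; rewrite mul1e.
have [v0 _|V0] := pickP [pred v : V | true]; last first.
  by move: p1; rewrite big_pred0// => /esym/eqP; rewrite onee_eq0.
move=> phi0; rewrite expectation_finite//.
have pE : p = (fine p)%:E by rewrite fineK// -(PY v0) fin_num_measure.
move: p1; rewrite pE sumEFin => -[]; rewrite sumr_const => p1.
under eq_bigr do rewrite -EFinM.
rewrite sumEFin -mulr_suml mulrC; congr (_ * _)%R%:E.
have V0 : (#|V|%:R != 0 :> R)%R by rewrite pnatr_eq0 -lt0n; apply/card_gt0P; exists v0.
by apply: (mulfI V0); rewrite mulfV// mulr_natl.
Qed.

End FiniteUniform.

Section EpochDraws.
Variables (R : realType) (d : measure_display) (Omega : measurableType d).
Variables (P : probability Omega R) (n N T : nat).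
Variables (i1 i2 : nat -> 'I_T -> 'I_N -> Omega -> 'I_n).
Variable s : nat -> Omega -> 'I_T * 'I_N.
Hypothesis indep : independent_uniform P (draws i1 i2 s).

Local Notation epoch_draw :=
  ({ffun 'I_T -> {ffun 'I_N -> 'I_n * 'I_n}} * ('I_T * 'I_N))%type.

Definition epoch_draws (e : nat) (w : Omega) : epoch_draw :=
  ([ffun t => [ffun j => (i1 e t j w, i2 e t j w)]], s e w).

Variable k : nat.

Definition history (w : Omega) : {ffun 'I_k -> epoch_draw} :=
  [ffun e : 'I_k => epoch_draws e w].

(** Finite index type for all draws of the first [k] epochs: independence is stated for injective
    families of labels over a finite type. *)
Let J : finType := ('I_k * 'I_T * 'I_N + 'I_k * 'I_T * 'I_N + 'I_k)%type.

Let label (j : J) : draw_label N T :=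
  match j with
  | inl (inl p) => IndexX p.1.1 p.1.2 p.2
  | inl (inr p) => IndexY p.1.1 p.1.2 p.2
  | inr e => Output N T e
  end.

Let label_inj : injective label.
Proof.
by move=> [[[[e t] j]|[[e t] j]]|e] [[[[e' t'] j']|[[e' t'] j']]|e'] //=
  => [[/val_inj-> -> ->]|[/val_inj-> -> ->]|[/val_inj->]].
Qed.

Let value (c : {ffun 'I_k -> epoch_draw}) (j : J) : draw_type n (label j) :=
  match j return draw_type n (label j) with
  | inl (inl p) => ((c p.1.1).1 p.1.2 p.2).1
  | inl (inr p) => ((c p.1.1).1 p.1.2 p.2).2
  | inr e => (c e).2
  end.

Let history_event c :
  [set w | history w = c] =
  [set w | forall j, draws i1 i2 s (label j) w = value c j].
Proof.
apply/seteqP; split => w /= h.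
  by move=> [[[[e t] j]|[[e t] j]]|e]; rewrite /= -h !ffunE/= ?ffunE.
 apply/ffunP => e; rewrite ffunE /epoch_draws.
rewrite [RHS]surjective_pairing; congr (_, _); last exact: (h (inr e)).
apply/ffunP => t; apply/ffunP => j; rewrite !ffunE [RHS]surjective_pairing.
congr (_, _); first exact: (h (inl (inl (e, t, j)))).
exact: (h (inl (inr (e, t, j)))).
Qed.

Lemma measurable_history c : measurable [set w | history w = c].
Proof.
have [mdraw _ _] := indep; rewrite history_event.
have -> : [set w | forall j, draws i1 i2 s (label j) w = value c j] =
    \bigcap_j [set w | draws i1 i2 s (label j) w = value c j].
  by apply/seteqP; split => w /= h j; [move=> _|]; exact: h.
by apply: fin_bigcap_measurable => // j _; exact: mdraw.
Qed.

(* The right-hand side does not depend on c; summing over c identifies it. *)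
Lemma history_uniform c :
  P [set w | history w = c] =
  (\prod_(j : J) (#|draw_type n (label j)|%:R^-1)%:E)%E.
Proof.
have [_ unif prodr] := indep; rewrite history_event (prodr _ _ label_inj).
by apply: eq_bigr => j _; rewrite unif.
Qed.

Lemma expectation_history (phi : {ffun 'I_k -> epoch_draw} -> R) :
  (forall c, 0 <= phi c) -> ('E_P[phi \o history] = (mean phi)%:E)%E.
Proof.
exact: (expectation_uniform measurable_history history_uniform).
Qed.

End EpochDraws.

Section ExpectedPotential.
Variables (R : realType) (d : measure_display) (Omega : measurableType d).
Variables (P : probability Omega R) (d1 d2 n N T : nat).
Local Notation point := ('rV[R]_d1 * 'rV[R]_d2)%type.
Variables (fs : 'I_n -> point -> R) (tau1 tau2 : R) (z0 : point).
Variables (i1 i2 : nat -> 'I_T -> 'I_N -> Omega -> 'I_n).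
Variable s : nat -> Omega -> 'I_T * 'I_N.
Hypothesis indep : independent_uniform P (draws i1 i2 s).
Hypotheses (n0 : (0 < n)%N) (N0 : (0 < N)%N) (T0 : (0 < T)%N).

Local Notation epoch_draw :=
  ({ffun 'I_T -> {ffun 'I_N -> 'I_n * 'I_n}} * ('I_T * 'I_N))%type.

Definition run_epoch (z : point) (p : epoch_draw) : point :=
  epoch fs tau1 tau2 z (fun t => p.1 t) p.2.

Local Notation iterate k w := (vr_agda fs tau1 tau2 z0
  (fun e t j => (i1 e t j w, i2 e t j w)) (fun e => s e w) k).

(** Output 0 already results from a full epoch, hence [k.+1] epochs for output [k]. *)
Lemma vr_agda_history k w :
  iterate k w = foldl run_epoch z0 (codom (history i1 i2 s k.+1 w)).
Proof.
have -> : codom (history i1 i2 s k.+1 w) =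
    map (fun e => epoch_draws i1 i2 s e w) (iota 0 k.+1).
  rewrite -val_enum_ord -map_comp /codom /image_mem.
  by apply: eq_map => e; rewrite ffunE.
have step e z : run_epoch z (epoch_draws i1 i2 s e w) =
    epoch fs tau1 tau2 z (fun t j => (i1 e t j w, i2 e t j w)) (s e w).
  pose i t : 'I_N -> 'I_n * 'I_n := (epoch_draws i1 i2 s e w).1 t.
  have iE : i = fun t j => (i1 e t j w, i2 e t j w).
    by apply/funext => t; apply/funext => j; rewrite /i !ffunE.
  by rewrite -iE.
elim: k => [|k IH]; first by rewrite /= step.
by rewrite -[k.+2]addn1 iotaD map_cat foldl_cat -IH [foldl _ _ _]step.
Qed.

Let draws0 : (0 < #|{: epoch_draw}|)%N.
Proof.
by rewrite !card_prod !card_ffun !card_ord !muln_gt0 !expn_gt0 N0 T0 card_prod card_ord muln_gt0 n0.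
Qed.

Lemma expectation_vr_agda (phi : point -> R) k : (forall z, 0 <= phi z) ->
  ('E_P[fun w => phi (iterate k w)] =
   (iter k.+1 (mean_step run_epoch) phi z0)%:E)%E.
Proof.
move=> phi0; rewrite -(mean_foldl_full run_epoch draws0).
rewrite -(expectation_history indep (k := k.+1)) => [|c]; last exact: phi0.
by congr ('E_P[_])%E; apply/funext => w; rewrite vr_agda_history.
Qed.

Hypothesis saddle : saddle_point_assumption (average fs).

Lemma potential_vr_agda k :
  potential (average fs) P (fun w => iterate k w) =
  (iter k.+1 (mean_step run_epoch) (initial_potential (average fs)) z0)%:E.
Proof.
rewrite /potential !expectation_vr_agda; [|exact: gap_b_ge0|exact: gap_a_ge0].
by rewrite -EFinM -EFinD -iter_mean_stepZ -iter_mean_stepD.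
Qed.

End ExpectedPotential.

(** * Parameters and complexity *)

Lemma absz_floor_bounds (R : realType) (x : R) : 0 <= x ->
  `|Num.floor x|%N%:R <= x < `|Num.floor x|%N%:R + 1.
Proof.
move=> x0; rewrite natr_absz ger0_norm ?real_floor_ge0 ?num_real//.
by have := floor_itv x; rewrite intrD.
Qed.

Lemma absz_ceil_bounds (R : realType) (x : R) : 0 <= x ->
  x <= `|Num.ceil x|%N%:R < x + 1.
Proof.
move=> x0; rewrite natr_absz ger0_norm; last first.
  by rewrite real_ceil_ge0 ?num_real//; exact: lt_le_trans x0.
by have := ceil_itv x; rewrite intrB => /andP[h1 h2]; rewrite h2/=; lra.
Qed.

(** [s] stands for beta^(1/2) and [nu] for n^(1/3); [N] and [T] round [B] and [K]. All rests on
    [u ^+ 3 * B = 1 / (80 + 160 * u)], which pins [u ^+ 3 * N] between absolute constants. *)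
Lemma loop_lengths (R : realType) (s nu kappa u B K : R) (N T : nat) :
  0 < s -> s <= 1 / 100 / 100 -> 1 <= nu -> 0 < kappa -> nu <= kappa ^+ 3 ->
  u = s / nu -> B = 1 / 40 * s ^- 3 * nu ^+ 3 * (2 + 4 * u)^-1 ->
  K = kappa ^+ 3 / nu -> N%:R <= B < N%:R + 1 -> K <= T%:R < K + 1 ->
  [/\ (0 < N)%N, (0 < T)%N, u ^+ 3 * N%:R <= 1 / 80,
      2 <= u ^+ 2 * kappa ^- 3 / 28 * (T%:R * N%:R) &
      T%:R * (2 * nu ^+ 3 + 4 * N%:R) <=
      2 * (2 + s ^- 3 / 20) * (nu ^+ 2 * kappa ^+ 3)].
Proof.
move=> s0 s1 nu1 k0 nuk uE BE KE /andP[NB BN] /andP[KT TK].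
have nu0 : 0 < nu by lra.
have u0 : 0 < u by rewrite uE divr_gt0.
have us : u <= s by rewrite uE ler_pdivrMr// ler_peMr// ltW.
have u1 : u <= 1 / 100 by lra.
have u2 : u <= 1 / 100 / 10 by lra.
have x0 : 0 < u ^+ 3 by rewrite exprn_gt0.
have xu : u ^+ 3 <= u by rewrite exprS ler_piMr ?exprn_ile1//; lra.
have Bx : u ^+ 3 * B * (80 + 160 * u) = 1.
  by rewrite BE uE; field; rewrite !gt_eqF//; rewrite ?addr_gt0 ?mulr_gt0.
have Bx0 : 0 <= u ^+ 3 * B by rewrite -(@pmulr_lge0 _ (80 + 160 * u)) ?Bx//; lra.
have Bx1 : u ^+ 3 * B <= 1 / 80 by nra.
have Bx2 : 1 / 82 <= u ^+ 3 * B by nra.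
have Nx : u ^+ 3 * N%:R <= 1 / 80.
  by apply: le_trans Bx1; rewrite ler_pM2l.
(* The floor costs at most [u ^+ 3 <= 1 / 1000], which [1 / 82] can afford. *)
have Nx1 : 1 / 100 <= u ^+ 3 * N%:R.
  by have := ler_wpM2l (ltW x0) (ltW BN); rewrite mulrDr mulr1; lra.
(* This is where [n <= kappa ^+ 9] enters, as [nu <= kappa ^+ 3]: the ceiling then at most doubles
   [K]. *)
have K1 : 1 <= K by rewrite KE ler_pdivlMr// mul1r.
have N0 : (0 < N)%N.
  by rewrite lt0n; apply/eqP => N0; move: Nx1; rewrite N0 mulr0; lra.
split => //.
- by rewrite -(ltr_nat R); lra.
- apply: (@le_trans _ _ (u ^+ 2 * kappa ^- 3 / 28 * (K * N%:R))); last first.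
    rewrite ler_wpM2l ?ler_wpM2r//; rewrite !mulr_ge0 ?invr_ge0 ?exprn_ge0 ?ltW//.
  (* The numerator is at least [1 / 100], so a small [s], that is a small beta, makes the quotient
     exceed 2. *)
  have -> : u ^+ 2 * kappa ^- 3 / 28 * (K * N%:R) = (u ^+ 3 * N%:R) / (28 * s).
    by rewrite KE uE; field; rewrite !gt_eqF.
  by rewrite ler_pdivlMr; lra.
have nu30 : 0 < nu ^+ 3 by rewrite exprn_gt0.
have Nle : N%:R <= nu ^+ 3 * s ^- 3 / 80.
  rewrite -(ler_pM2l x0); apply: le_trans Nx _.
  by rewrite uE le_eqVlt; apply/orP; left; apply/eqP; field; rewrite !gt_eqF.
apply: (@le_trans _ _ (2 * K * (nu ^+ 3 * (2 + s ^- 3 / 20)))).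
  by apply: ler_pM => //; [have := ler0n R N; lra | lra | lra].
by rewrite KE le_eqVlt; apply/orP; left; apply/eqP; field; rewrite !gt_eqF.
Qed.

Lemma epoch_contracts (R : realType) (d1 d2 n : nat)
    (fs : 'I_n -> 'rV[R]_d1 * 'rV[R]_d2 -> R) (l mu u tau1 tau2 : R) (N T : nat) :
  let w := mu / l in
  (0 < n)%N -> (forall i z, differentiable (fs i) z) ->
  (forall i, lipschitz_gradients l (fs i)) ->
  saddle_point_assumption (average fs) -> two_sided_PL mu mu (average fs) ->
  0 < mu -> mu <= l -> 0 < u -> u <= 1 / 100 ->
  tau1 = u ^+ 2 * w ^+ 2 / (28 * l) -> tau2 = u ^+ 2 / l ->
  (0 < N)%N -> (0 < T)%N -> u ^+ 3 * N%:R <= 1 / 80 ->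
  2 <= u ^+ 2 * w ^+ 3 / 28 * (T%:R * N%:R) ->
  forall z, mean_step (@run_epoch R d1 d2 n N T fs tau1 tau2)
    (initial_potential (average fs)) z <= 1 / 2 * initial_potential (average fs) z.
Proof.
move=> w n0 dfs lip saddle PL mu0 mul u0 u1 tau1E tau2E N0 T0 uN rTN z.
set f := average fs; set pot := initial_potential f.
have pot0 z' : 0 <= pot z'.
  by rewrite addr_ge0 ?mulr_ge0 ?gap_a_ge0 ?gap_b_ge0.
(* The weight falls at each step by exactly what [vr_step_le] adds to the coefficient of [sqdist],
   and vanishes at [j = N]. *)
pose Phi zt j z' := pot z' + l * (u ^+ 4 / 5 * (N - j)%:R) * sqdist zt z'.
have l0 : 0 < l by exact: lt_le_trans mul.
have := @epoch_sum_le R d1 d2 n fs tau1 tau2 N T n0 pot Phi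
  (u ^+ 2 * w ^+ 3 / 28) pot0 _ _ _ z N0 T0.
rewrite -[mean_epoch _ _ _ _ _ _ _]/(mean_step (@run_epoch R d1 d2 n N T fs tau1 tau2) pot z).
set U := mean_step _ _ _ => h.
have U0 : 0 <= U by apply: mean_ge0.
suff /(le_trans _) : u ^+ 2 * w ^+ 3 / 28 * (T%:R * N%:R) * U <= pot z.
  by move=> /(_ (2 * U)); rewrite ler_wpM2r//; lra.
apply: h.
- move=> zt j z' jN.
  have u40 : 0 <= u ^+ 4 / 5 by rewrite divr_ge0 ?exprn_ge0 ?(ltW u0).
  have c0 : 0 <= u ^+ 4 / 5 * (N - j.+1)%:R.
    by rewrite mulr_ge0.
  have cu : u ^+ 4 / 5 * (N - j.+1)%:R <= u / 400.
    apply: (@le_trans _ _ (u ^+ 4 / 5 * N%:R)).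
      by rewrite ler_wpM2l// ler_nat leq_subr.
    have -> : u ^+ 4 / 5 * N%:R = u / 5 * (u ^+ 3 * N%:R) by field.
    have -> : u / 400 = u / 5 * (1 / 80) by field.
    by rewrite ler_wpM2l ?divr_ge0 ?(ltW u0).
  have := vr_step_le n0 dfs lip saddle PL mu0 mul u0 u1 zt z' c0 cu tau1E tau2E.
  rewrite /mean_step /Phi -/f -/pot -/w.
  have -> : u ^+ 4 / 5 * (N - j.+1)%:R + u ^+ 4 / 5 = u ^+ 4 / 5 * (N - j)%:R.
    by rewrite -{2}[u ^+ 4 / 5]mulr1 -mulrDr natr1 -subSn// subSS.
  by lra.
- move=> zt; rewrite /Phi /sqdist !subrr.
  by rewrite !sqr_enorm /dot !big1 ?addr0 ?mulr0 ?addr0// => i _; rewrite mxE mul0r.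
- by move=> zt z'; rewrite /Phi subnn mulr0 mulr0 mul0r addr0.
Qed.

(** Take [k] the floor of [2 * M]: as [ln 2 >= 1 / 2], [2 ^+ k.+1] exceeds [U 0 / eps], and
    [k.+1 <= 2 * M + 1 <= 3 * M]. *)
Lemma iterations_suffice (R : realType) (U : nat -> R) (eps : R) :
  0 < eps -> (forall k, U k.+1 <= 1 / 2 * U k) -> 0 <= U 0%N ->
  exists2 k : nat, U k.+1 <= eps & k.+1%:R <= 3 * Num.max 1 (ln (U 0%N / eps)).
Proof.
move=> eps0 Uhalf U0; set M := Num.max _ _.
have M1 : 1 <= M by rewrite le_max lexx.
have M0 : 0 <= 2 * M by lra.
have /andP[kM Mk] := absz_floor_bounds M0; set k := `|_|%N in kM Mk.
have Uk j : U j <= (1 / 2) ^+ j * U 0%N.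
  elim: j => [|j IH]; first by rewrite expr0 mul1r.
  by have := Uhalf j; rewrite exprS; lra.
exists k; last by rewrite -natr1; lra.
apply: le_trans (Uk _) _.
(* A zero potential is set apart, since [ln 0] is only a default value. *)
have [->|U00] := eqVneq (U 0%N) 0; first by rewrite mulr0 ltW.
have r0 : 0 < U 0%N / eps by rewrite divr_gt0// lt0r U00.
have ln2 : 1 / 2 <= ln 2 :> R.
  have := @le_ln1Dx R (- (1 / 2)); rewrite (_ : 1 + - (1 / 2) = 2^-1); last by field.
  rewrite lnV ?posrE// => h; have {}h := h _; lra.
have : ln (U 0%N / eps) <= ln (2 ^+ k.+1).
  rewrite lnXn// -[ln 2 *+ _]mulr_natr -[k.+1%:R]natr1.
  have : ln (U 0%N / eps) <= M by rewrite le_max lexx orbT.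
  have k0 : 0 <= k%:R + 1 :> R by rewrite natr1.
  have := ler_wpM2r k0 ln2; lra.
rewrite ler_ln ?posrE ?exprn_gt0// ler_pdivrMr// => h.
by rewrite div1r exprVn ler_pdivrMl ?exprn_gt0.
Qed.

Theorem theorem4p2 (R : realType) :
  exists alpha beta C : R, [/\ 0 < alpha, 0 < beta, 0 < C &
  forall (d1 d2 n : nat) (fs : 'I_n -> 'rV[R]_d1 * 'rV[R]_d2 -> R)
    (l mu1 mu2 : R),
  let f := average fs in
  let kappa := l / Num.min mu1 mu2 in
  (0 < n)%N ->
  (forall i, continuously_differentiable (fs i)) ->
  (forall i, lipschitz_gradients l (fs i)) ->
  saddle_point_assumption f ->
  0 < mu1 -> 0 < mu2 -> two_sided_PL mu1 mu2 f ->
  mu1 <= l -> mu2 <= l ->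
  n%:R <= kappa ^+ 9 ->
  let tau1 := beta / (28 * kappa ^+ 2 * l * n%:R `^ (2 / 3)) in
  let tau2 := beta / (l * n%:R `^ (2 / 3)) in
  let N := `|Num.floor (alpha * beta `^ (- (3 / 2)) * n%:R *
      (2 + 4 * beta `^ (1 / 2) * n%:R `^ (- (1 / 3)))^-1)|%N in
  let T := `|Num.ceil (kappa ^+ 3 * n%:R `^ (- (1 / 3)))|%N in
  [/\ (0 < N)%N, (0 < T)%N &
  forall (d : measure_display) (Omega : measurableType d)
    (P : probability Omega R)
    (i1 i2 : nat -> 'I_T -> 'I_N -> Omega -> 'I_n)
    (s : nat -> Omega -> 'I_T * 'I_N)
    (z0 : 'rV[R]_d1 * 'rV[R]_d2),
  independent_uniform P (draws i1 i2 s) ->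
  let z k w := vr_agda fs tau1 tau2 z0
    (fun k' t j => (i1 k' t j w, i2 k' t j w)) (fun k' => s k' w) k in
  let Pot k := potential f P (z k) in
  (forall k, (Pot k.+1 <= (1 / 2)%:E * Pot k)%E) /\
  (forall eps : R, 0 < eps -> exists k : nat,
    (Pot k <= eps%:E)%E /\
    (k.+1 * epoch_cost n N T)%:R <=
      C * (n%:R `^ (2 / 3) * kappa ^+ 3 *
           Num.max 1 (ln (initial_potential f z0 / eps))))]].
Proof.
have [s s0 s1] : exists2 s : R, 0 < s & s <= 1 / 100 / 100.
  by exists (1 / 100 / 100); rewrite ?divr_gt0.
(* alpha = 1/40 gives [u ^+ 3 * N <= 1 / 80]; the last constant is the cost factor of [loop_lengths]
   times the 3 of [iterations_suffice]. *)
exists (1 / 40), (s ^+ 2), (6 * (2 + s ^- 3 / 20)).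
have C0 : 0 < 6 * (2 + s ^- 3 / 20).
  by rewrite mulr_gt0// addr_gt0// divr_gt0// invr_gt0 exprn_gt0.
split; [by rewrite divr_gt0 | by rewrite exprn_gt0 | exact: C0 | ].
move=> d1 d2 n fs l mu1 mu2 f kappa n0 cd lip saddle mu10 mu20 PL12 mu1l mu2l nk.
move=> tau1 tau2 N T.
pose mu := Num.min mu1 mu2.
have mu0 : 0 < mu by rewrite lt_min mu10.
have mul : mu <= l by rewrite ge_min mu1l.
have l0 : 0 < l by exact: lt_le_trans mul.
have PL : two_sided_PL mu mu f.
  by apply: two_sided_PL_min PL12 => //; rewrite ge_min lexx ?orbT.
have dfs i z : differentiable (fs i) z by have [] := cd i.
have k0 : 0 < kappa by exact: divr_gt0.
pose nu : R := n%:R `^ (1 / 3).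
have nu_ge0 : 0 <= nu by exact: powR_ge0.
have powRXn (x y : R) m : 0 <= x -> x `^ (y * m%:R) = (x `^ y) ^+ m.
  by move=> x0; rewrite powRrM powR_mulrn// powR_ge0.
have nu3 : nu ^+ 3 = n%:R.
  by rewrite -powRXn// divfK// powRr1.
have nu2 : n%:R `^ (2 / 3) = nu ^+ 2 by rewrite -powRXn//; congr (_ `^ _); field.
have nui : n%:R `^ (- (1 / 3)) = nu^-1 by rewrite powRN.
have nu1 : 1 <= nu.
  rewrite leNgt; apply/negP => nu1.
  have : nu ^+ 3 < 1 by rewrite exprn_ilt1.
  by rewrite nu3 ltNge ler1n n0.
have nu0 : 0 < nu by exact: lt_le_trans nu1.
have nuk : nu <= kappa ^+ 3.
  by rewrite -(@ler_pXn2r _ 3) ?nnegrE ?exprn_ge0 ?(ltW k0)// -exprM nu3.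
have sqrt_beta : (s ^+ 2) `^ (1 / 2) = s.
  by rewrite -powR_mulrn ?(ltW s0)// -powRrM [_ * _](_ : _ = 1) ?powRr1 ?(ltW s0)//; field.
have beta32 : (s ^+ 2) `^ (- (3 / 2)) = s ^- 3.
  rewrite powRN; congr (_^-1); rewrite -{2}sqrt_beta -powRXn ?sqr_ge0//.
  by congr (_ `^ _); field.
pose u := s / nu.
have u0 : 0 < u by rewrite divr_gt0.
have NE : N = `|Num.floor (1 / 40 * s ^- 3 * nu ^+ 3 * (2 + 4 * u)^-1)|%N.
  by rewrite /N beta32 sqrt_beta nui -nu3 -[4 * s / nu]mulrA.
have TE : T = `|Num.ceil (kappa ^+ 3 / nu)|%N by rewrite /T nui.
have [N0 T0 uN rTN cost] : [/\ (0 < N)%N, (0 < T)%N, u ^+ 3 * N%:R <= 1 / 80,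
      2 <= u ^+ 2 * kappa ^- 3 / 28 * (T%:R * N%:R) &
      T%:R * (2 * nu ^+ 3 + 4 * N%:R) <=
      2 * (2 + s ^- 3 / 20) * (nu ^+ 2 * kappa ^+ 3)].
  apply: (@loop_lengths _ s nu kappa u _ _ N T s0 _ nu1 k0 nuk erefl erefl erefl).
  - exact: s1.
  - rewrite NE; apply: absz_floor_bounds.
    have s30 : 0 <= s ^- 3 by rewrite invr_ge0 exprn_ge0 ?(ltW s0).
    have u40 : 0 <= (2 + 4 * u)^-1 by rewrite invr_ge0; lra.
    have nu30 : 0 <= nu ^+ 3 by rewrite exprn_ge0.
    by apply: mulr_ge0 u40; apply: mulr_ge0 nu30; apply: mulr_ge0 s30; rewrite divr_ge0.
  - rewrite TE; apply: absz_ceil_bounds.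
    by rewrite divr_ge0 ?exprn_ge0 ?(ltW k0).
split => // d Omega P i1 i2 s' z0 indep z Pot.
pose pot := initial_potential f.
pose K : ('rV[R]_d1 * 'rV[R]_d2 -> R) -> 'rV[R]_d1 * 'rV[R]_d2 -> R :=
  mean_step (@run_epoch R d1 d2 n N T fs tau1 tau2).
have PotE k : Pot k = (iter k.+1 K pot z0)%:E.
  exact: (potential_vr_agda tau1 tau2 z0 indep n0 N0 T0 saddle).
have Khalf x : K pot x <= 1 / 2 * pot x.
  have us : u <= 1 / 100.
    apply: (@le_trans _ _ s); first by rewrite ler_pdivrMr// ler_peMr// ltW.
    by lra.
  apply: (epoch_contracts n0 dfs lip saddle PL mu0 mul u0 us) => //.
  - by rewrite /tau1 /u nu2 /kappa -/mu; field; rewrite !gt_eqF.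
  - by rewrite /tau2 /u nu2; field; rewrite !gt_eqF.
  - by rewrite -exprVn invf_div in rTN.
have half k : iter k.+1 K pot z0 <= 1 / 2 * iter k K pot z0.
  by rewrite iterSr -iter_mean_stepZ; apply: le_iter_mean_step.
have pot0 : 0 <= pot z0.
  by rewrite addr_ge0 ?mulr_ge0 ?(gap_a_ge0 saddle) ?(gap_b_ge0 saddle).
split=> [k|eps eps0]; first by rewrite !PotE -EFinM lee_fin; exact: half.
(* Here [U 0] is the potential of the input point, and [Pot k] is [U k.+1], reached after [k.+1]
   epochs. *)
have [k Uk kM] := iterations_suffice (U := fun k => iter k K pot z0) eps0 half pot0.
exists k; split; first by rewrite PotE lee_fin.
rewrite /= in kM; rewrite -/pot nu2.
have -> : epoch_cost n N T = (T * (2 * n + 4 * N))%N.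
  by rewrite /epoch_cost !sum_nat_const !card_ord addnn mul2n [(N * _)%N]mulnC.
rewrite !natrM natrD !natrM -nu3.
set M := Num.max _ _ in kM *.
apply: (@le_trans _ _ (3 * M * (2 * (2 + s ^- 3 / 20) * (nu ^+ 2 * kappa ^+ 3)))).
  by apply: ler_pM => //; rewrite mulr_ge0 ?addr_ge0 ?mulr_ge0 ?exprn_ge0.
by rewrite le_eqVlt; apply/orP; left; apply/eqP; ring.
Qed.
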